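(* Let $q$ be a power of a prime and let $n\ge 1$. Let $z=\alpha I$ be an element of the center of $\mathrm{U}(n,\mathbb{F}_{q^2})$, where $\alpha\in T_1$, and let $\chi^{\boldsymbol{\lambda}}$, $\boldsymbol{\lambda}\in\mathcal{P}_n^{\Theta}$, be an irreducible character of $\mathrm{U}(n,\mathbb{F}_{q^2})$. Define $\omega_{\boldsymbol{\lambda}}\in L_1$ by $$\omega_{\boldsymbol{\lambda}}=\prod_{\varphi\in\Theta}\prod_{\xi\in\varphi}\xi^{|\boldsymbol{\lambda}^{(\varphi)}|}.$$ Then $\chi^{\boldsymbol{\lambda}}(z)=\omega_{\boldsymbol{\lambda}}(\alpha)_1\,\chi^{\boldsymbol{\lambda}}(1)$.
   Context: **Group.** $\mathrm{U}(n,\mathbb{F}_{q^2})=\{g\in\mathrm{GL}(n,\bar{\mathbb{F}}_q): F(g)=g\}$, where $F((a_{ij}))={}^T(a_{ij}^q)^{-1}$. Its center is $\{\alpha I:\alpha\in T_1\}$. **Orbits and character groups.** $F$ acts on $\bar{\mathbb{F}}_q^\times$ by $\alpha\mapsto\alpha^{-q}$; $\Phi$ is the set of $F$-orbits of $\bar{\mathbb{F}}_q^\times$, and $f_\alpha$ is the orbit of $\alpha$. For $m\ge1$, $T_m=\{\alpha\in\bar{\mathbb{F}}_q^\times:\alpha^{(-q)^m}=\alpha\}$, so $T_1=\{\alpha:\alpha^{q+1}=1\}$, and $\widehat{T}_m$ is the group of homomorphisms $T_m\to\mathbb{C}^\times$. For $r\mid m$ the norm map is $N_{m,r}:T_m\to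 T_r$, $\alpha\mapsto\prod_{i=0}^{m/r-1}\alpha^{(-q)^{ri}}$, and $N_{m,r}^\star:\widehat{T}_r\to\widehat{T}_m$, $\xi\mapsto\xi\circ N_{m,r}$, is an embedding. Let $L=\varinjlim\widehat{T}_m$ with respect to the maps $N^\star_{m,r}$. $F$ acts on $L$ by $\xi\mapsto\xi\circ F=\xi^{-q}$; $\Theta$ is the set of $F$-orbits on $L$. The set $L_m$ of $F^m$-fixed elements of $L$ is identified with $\widehat{T}_m$. For $\xi\in L_m$ and $a\in T_m$, $\xi(a)_m$ denotes the value at $a$ of $\xi$ regarded as an element of $\widehat{T}_m$. For each $\varphi\in\Theta$, $\prod_{\xi\in\varphi}\xi$ is $F$-fixed, hence lies in $L_1$. **Multi-partitions.** Let $\mathcal{P}$ be the set of all partitions, including the empty partition. For $\mathcal{X}=\Phi$ or $\Theta$, $\mathcal{P}_n^{\mathcal{X}}$ is the set of functions $\boldsymbol{\lambda}:\mathcal{X}\to\mathcal{P}$, $X\mapsto\boldsymbol{\lambda}^{(X)}$, with $\sum_{X}|X|\,|\boldsymbol{\lambda}^{(X)}|=n$. For a partition $\nu$, $n(\nu)=\sum_j(j-1)\nu_j$; for a multi-partition, $n(\boldsymbol{\lambda})=\sum_X|X|\,n(\boldsymbol{\lambda}^{(X)})$. **Conjugacy classes.** The conjugacy classes of $\mathrm{U}(n,\mathbb{F}_{q^2})$ are parametrized by $\mathcal{P}_n^\Phi$: $K^{\boldsymbol{\mu}}$ is the class of elements such that, for each $f\in\Phi$ and $\alpha\in f$, the sizes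 of the Jordan blocks with eigenvalue $\alpha$ are the parts of $\boldsymbol{\mu}^{(f)}$. In particular $\alpha I$ ($\alpha \in T_1$) lies in the class with $\boldsymbol{\mu}^{(\{\alpha\})}=(1^n)$ and all other $\boldsymbol{\mu}^{(f)}=\varnothing$. **The characters $\chi^{\boldsymbol{\lambda}}$.** For each $f\in\Phi$ and $\varphi\in\Theta$ take infinite sets of indeterminates $X^{(f)}=\{X_i^{(f)}\}_{i\ge1}$ and $Y^{(\varphi)}=\{Y^{(\varphi)}_i\}_{i\ge1}$. Symmetric functions (over $\mathbb{C}$) in the $Y$ variables are expressed through those in the $X$ variables by setting, on power sums, $$p_k(Y^{(\varphi)})=(-1)^{k|\varphi|-1}\sum_{\alpha\in T_{k|\varphi|}}\xi(\alpha)_{k|\varphi|}\;p_{k|\varphi|/|f_\alpha|}(X^{(f_\alpha)}),\qquad \xi\in\varphi,$$ where $p_z=0$ if $z$ is not an integer. For $\boldsymbol{\mu}\in\mathcal{P}_n^\Phi$ put $P_{\boldsymbol{\mu}}=(-q)^{-n(\boldsymbol{\mu})}\prod_{f\in\Phi}P_{\boldsymbol{\mu}^{(f)}}(X^{(f)};(-q)^{-|f|})$, where $P_\mu(X;t)$ is the Hall-Littlewood function, and for $\boldsymbol{\lambda}\in\mathcal{P}_n^\Theta$ put $s_{\boldsymbol{\lambda}}=\prod_{\varphi\in\Theta}s_{\boldsymbol{\lambda}^{(\varphi)}}(Y^{(\varphi)})$, where $s_\lambda$ is the Schur function. The functions $P_{\boldsymbol{\mu}}$, $\boldsymbol{\mu}\in\mathcal{P}^\Phi_n$,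 are linearly independent, and $\chi^{\boldsymbol{\lambda}}$ is the class function on $\mathrm{U}(n,\mathbb{F}_{q^2})$ whose value $\chi^{\boldsymbol{\lambda}}(\boldsymbol{\mu})$ on $K^{\boldsymbol{\mu}}$ is determined by $$(-1)^{\lfloor n/2\rfloor+n(\boldsymbol{\lambda})}s_{\boldsymbol{\lambda}}=\sum_{\boldsymbol{\mu}\in\mathcal{P}_n^\Phi}\chi^{\boldsymbol{\lambda}}(\boldsymbol{\mu})P_{\boldsymbol{\mu}}.$$ It is a known theorem that $\boldsymbol{\lambda}\mapsto\chi^{\boldsymbol{\lambda}}$ is a bijection from $\mathcal{P}_n^\Theta$ to the set of irreducible complex characters of $\mathrm{U}(n,\mathbb{F}_{q^2})$. *)

(* Defs.v *)
From HB Require Import structures.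
From mathcomp Require Import all_boot all_order all_algebra perm.
From mathcomp Require Import finmap boolp classical_sets cardinality fsbigop.
From mathcomp Require Import reals complex.
(* [monalg] and [mpoly] both define the notation {mpoly R[n]}; the one of
   [mpoly] is used throughout. *)
From mathcomp Require monalg.
Import -(notations) monalg.
From mathcomp Require Import mpoly.

Set Implicit Arguments.
Unset Strict Implicit.
Unset Printing Implicit Defensive.

Import Order.TTheory GRing.Theory Num.Theory.

Local Open Scope quotient_scope.
Local Open Scope classical_set_scope.
Local Open Scope ring_scope.

Definition is_partition (s : seq nat) : bool := sorted geq s && (0%N \notin s).

Record partn := Partn { parts :> seq nat; partsP : is_partition parts }.

HB.instance Definition _ := [isSub for parts].
HB.instance Definition _ := [Choice of partn by <:].

Definition part0 : partn := @Partn [::] isT.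

Definition psize (la : partn) : nat := sumn la.

(* Parts are numbered from 0 here, so that the factor j - 1 becomes j. *)
Definition pn (la : partn) : nat := (\sum_(j < size la) j * nth 0 la j)%N.

(* The orbit of x under the group generated by F. Forward iterates suffice: F
   is only used below as a bijection all of whose points are periodic. *)
Definition iorbit (T : Type) (F : T -> T) (x : T) : set T :=
  [set iter i F x | i in [set: nat]].

Definition ocard (T : choiceType) (X : set T) : nat := #|` fset_set X|.

(* A function from a set XX of orbits in T to partitions is represented by its
   extension by the empty partition to all subsets of T. It has finite support
   as soon as its size is finite, since orbits are nonempty. *)
Definition mpartn (T : choiceType) := {fsfun set T -> partn with part0}.

Definition mparts (T : choiceType) (XX : set (set T)) (n : nat)
    : set (mpartn T) :=
  [set la | (forall X, X \in finsupp la -> XX X) /\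
            (\sum_(X <- finsupp la) ocard X * psize (la X))%N = n].

Definition mpn (T : choiceType) (la : mpartn T) : nat :=
  (\sum_(X <- finsupp la) ocard X * pn (la X))%N.

Section Frobenius.

Variables (K : fieldType) (q : nat).

Definition Frob (a : K) : K := a ^ (- q%:Z).

Definition Phi : set (set K) := [set iorbit Frob a | a in [set a | a != 0]].

Definition Tm (m : nat) : set K :=
  [set a | a != 0 /\ a ^ ((- q%:Z) ^+ m) = a].

Definition normT (m r : nat) (a : K) : K :=
  \prod_(i < m %/ r) a ^ ((- q%:Z) ^+ (r * i)).

Lemma TmM m a b : Tm m a -> Tm m b -> Tm m (a * b).
Proof.
by move=> [a0 aT] [b0 bT]; split; rewrite ?mulf_neq0 // expfzMl aT bT.
Qed.

Lemma exprz_prod n (F : 'I_n -> K) (z : int) :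
  (\prod_(i < n) F i) ^ z = \prod_(i < n) F i ^ z.
Proof.
by apply: (big_morph (fun x : K => x ^ z)) => [x y|]; rewrite ?expfzMl ?exp1rz.
Qed.

Lemma Frob_Tm m a : Tm m a -> Tm m (Frob a).
Proof.
move=> [a0 aT]; split; first exact: expfz_neq0.
by rewrite /Frob exprz_exp mulrC -exprz_exp aT.
Qed.

Lemma FrobM a b : Frob (a * b) = Frob a * Frob b.
Proof. exact: expfzMl. Qed.

Lemma normT_Frob m r a : normT m r (Frob a) = Frob (normT m r a).
Proof.
rewrite /normT /Frob exprz_prod; apply: eq_bigr => i _.
by rewrite !exprz_exp mulrC.
Qed.

Lemma normTM m r a b : normT m r (a * b) = normT m r a * normT m r b.
Proof. by rewrite /normT -big_split; apply: eq_bigr => i _; rewrite expfzMl. Qed.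

Lemma normT_Tm m r a : (r %| m)%N -> Tm m a -> Tm r (normT m r a).
Proof.
move=> rm [a0 aT]; split.
  by apply/prodf_neq0 => i _; exact: expfz_neq0.
rewrite /normT; set s := (m %/ r)%N.
pose u i := a ^ ((- q%:Z) ^+ (r * i)).
have us : u s = u 0%N by rewrite /u mulnC divnK // aT muln0 expr0 expr1z.
have u0 : u 0%N != 0 by exact: expfz_neq0.
apply: (mulfI u0); transitivity (\prod_(i < s.+1) u i); last first.
  by rewrite big_ord_recr /= us mulrC.
rewrite big_ord_recl; congr (_ * _); rewrite exprz_prod; apply: eq_bigr => i _.
by rewrite /u exprz_exp -exprD lift0 mulnS addnC.
Qed.

Lemma normT_id m a : (0 < m)%N -> normT m m a = a.
Proof.
by move=> m0; rewrite /normT divnn m0 big_ord1 muln0 expr0 expr1z.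
Qed.

Lemma normT_comp k r m a : (0 < r)%N -> (m %| r)%N -> (r %| k)%N ->
  normT r m (normT k r a) = normT k m a.
Proof.
move=> r0 /dvdnP[s rE] /dvdnP[t kE]; subst r k.
have m0 : (0 < m)%N by move: r0; rewrite muln_gt0 => /andP[].
have s0 : (0 < s)%N by move: r0; rewrite muln_gt0 => /andP[].
rewrite /normT mulnK // mulnK ?muln_gt0 ?s0 // mulnA mulnK //.
under eq_bigr do rewrite exprz_prod.
rewrite exchange_big /=.
rewrite -(big_mkord xpredT (fun i => a ^ ((- q%:Z) ^+ (m * i)))) big_nat_mul.
rewrite big_mkord; apply: eq_bigr => j _.
rewrite -[(j * s)%N]add0n big_addn mulSn addnK big_mkord.
apply: eq_bigr => i _.
rewrite exprz_exp -exprD; congr (a ^ (_ ^+ _)).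
by rewrite mulnDr addnC; congr addn; rewrite mulnC mulnA mulnC.
Qed.

End Frobenius.

Section DirectLimit.

Variables (K : fieldType) (C : fieldType) (q : nat).

(* Characters of T_m are given by functions on K of which only the restriction
   to T_m matters. *)
Definition is_char (m : nat) (xi : K -> C) : Prop :=
  (forall a, Tm q m a -> xi a != 0) /\
  (forall a b, Tm q m a -> Tm q m b -> xi (a * b) = xi a * xi b).

Record lchar := LChar {
  lev : nat;
  chr :> K -> C;
  lev_gt0 : (0 < lev)%N;
  chrP : is_char lev chr }.

HB.instance Definition _ := gen_eqMixin lchar.
HB.instance Definition _ := gen_choiceMixin lchar.

Definition lchar_eq (x y : lchar) : Prop :=
  exists k : nat, [/\ (0 < k)%N, (lev x %| k)%N, (lev y %| k)%N &
    forall a, Tm q k a -> x (normT q k (lev x) a) = y (normT q k (lev y) a)].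

Definition lchar_eqb (x y : lchar) : bool := `[< lchar_eq x y >].

Lemma lchar_eq_refl : reflexive lchar_eqb.
Proof. by move=> x; apply/asboolP; exists (lev x); split => //; exact: lev_gt0. Qed.

Lemma lchar_eq_sym : ssrbool.symmetric lchar_eqb.
Proof.
move=> x y; apply/asboolP/asboolP => -[k [k0 xk yk xy]];
  by exists k; split => // a /xy.
Qed.

Lemma lchar_eq_trans : transitive lchar_eqb.
Proof.
move=> y x z /asboolP[k [k0 xk yk xy]] /asboolP[l [l0 yl zl yz]].
apply/asboolP; exists (k * l)%N; split; rewrite ?muln_gt0 ?k0 //.
- exact: dvdn_mulr.
- exact: dvdn_mull.
move=> a aT; have kkl := dvdn_mulr l (dvdnn k); have lkl := dvdn_mull k (dvdnn l).
rewrite -(normT_comp q a k0 xk kkl) -(normT_comp q a l0 zl lkl).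
rewrite xy; last exact: normT_Tm aT.
rewrite -yz; last exact: normT_Tm aT.
by rewrite !normT_comp.
Qed.

Canonical lchar_equiv :=
  EquivRel lchar_eqb lchar_eq_refl lchar_eq_sym lchar_eq_trans.

(* The direct limit of the character groups of the T_m along N_(m,r)^*. *)
Definition L : Type := {eq_quot lchar_eqb}.
HB.instance Definition _ := Choice.on L.
HB.instance Definition _ : EqQuotient lchar lchar_eqb L := EqQuotient.on L.

Definition piL (x : lchar) : L := \pi_L x.

Lemma piLP x y : lchar_eq x y <-> piL x = piL y.
Proof.
split=> [xy|].
  by apply/eqP; rewrite eqmodE; apply/asboolP.
by move/eqP; rewrite eqmodE => /asboolP.
Qed.

Lemma reprL x : piL (repr x) = x.
Proof. by rewrite /piL reprK. Qed.

Lemma one_char : is_char 1 (fun=> 1).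
Proof. by split=> [a _|a b _ _]; rewrite ?oner_eq0 ?mulr1. Qed.

Lemma mul_char (x y : lchar) : is_char (lev x * lev y)
  (fun a => x (normT q (lev x * lev y) (lev x) a) *
            y (normT q (lev x * lev y) (lev y) a)).
Proof.
have xT a (aT : Tm q (lev x * lev y) a) := normT_Tm (dvdn_mulr _ (dvdnn (lev x))) aT.
have yT a (aT : Tm q (lev x * lev y) a) := normT_Tm (dvdn_mull _ (dvdnn (lev y))) aT.
case: (chrP x) (chrP y) => [x0 xM] [y0 yM]; split.
  by move=> a aT; rewrite mulf_neq0 ?x0 ?y0; auto.
by move=> a b aT bT; rewrite !normTM xM ?yM; auto; rewrite mulrACA.
Qed.

Lemma frob_char (x : lchar) : is_char (lev x) (fun a => x (Frob q a)).
Proof.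
case: (chrP x) => [x0 xM]; split=> [a /Frob_Tm/x0 //|a b aT bT].
by rewrite FrobM xM //; exact: Frob_Tm.
Qed.

Definition one_lchar : lchar := LChar (ltn0Sn 0) one_char.

Lemma mul_lev_gt0 (x y : lchar) : (0 < lev x * lev y)%N.
Proof. by rewrite muln_gt0 !lev_gt0. Qed.

Definition mul_lchar (x y : lchar) : lchar := LChar (mul_lev_gt0 x y) (mul_char x y).

Definition frob_lchar (x : lchar) : lchar := LChar (lev_gt0 x) (frob_char x).

Definition oneL : L := piL one_lchar.
Definition mulL (x y : L) : L := piL (mul_lchar (repr x) (repr y)).
Definition frobL (x : L) : L := piL (frob_lchar (repr x)).
Definition expL (x : L) (k : nat) : L := iter k (mulL x) oneL.

Lemma lchar_eq_repr x : lchar_eq (repr (piL x)) x.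
Proof. by apply/piLP; rewrite reprL. Qed.

Lemma lchar_eq_wit (x y : lchar) : lchar_eq x y -> exists2 k, (0 < k)%N &
  forall l, (k %| l)%N -> [/\ (lev x %| l)%N, (lev y %| l)%N & forall a,
    Tm q l a -> x (normT q l (lev x) a) = y (normT q l (lev y) a)].
Proof.
move=> [k [k0 xk yk xy]]; exists k => // l kl.
split; [exact: dvdn_trans kl|exact: dvdn_trans kl|] => a aT.
rewrite -(normT_comp q a k0 xk kl) -(normT_comp q a k0 yk kl).
by apply: xy; exact: normT_Tm aT.
Qed.

Lemma mulL_pi x y : mulL (piL x) (piL y) = piL (mul_lchar x y).
Proof.
apply/piLP; set x' := repr _; set y' := repr _.
have [k k0 xk] := lchar_eq_wit (lchar_eq_repr x : lchar_eq x' x).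
have [l l0 yl] := lchar_eq_wit (lchar_eq_repr y : lchar_eq y' y).
pose m := (k * l * (lev x' * lev y') * (lev x * lev y))%N.
have [] := xk m; first by rewrite /m -!mulnA dvdn_mulr.
move=> x'm xm xE; have [] := yl m.
  by rewrite /m -!mulnA dvdn_mull // dvdn_mulr.
move=> y'm ym yE.
have x'y'm : (lev x' * lev y' %| m)%N by rewrite /m dvdn_mulr // dvdn_mull.
have xym : (lev x * lev y %| m)%N by rewrite /m dvdn_mull.
exists m; split.
- by rewrite /m !muln_gt0 k0 l0 !lev_gt0.
- exact: x'y'm.
- exact: xym.
move=> a aT /=.
rewrite !normT_comp ?muln_gt0 ?lev_gt0 ?xE ?yE //;
  by [exact: dvdn_mulr | exact: dvdn_mull].
Qed.

Lemma frobL_pi x : frobL (piL x) = piL (frob_lchar x).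
Proof.
apply/piLP; have [k [k0 xk yk xy]] := lchar_eq_repr x; exists k; split => //= a aT.
by rewrite -!normT_Frob xy //; exact: Frob_Tm.
Qed.

Lemma mulLC : commutative mulL.
Proof.
move=> x y; rewrite -(reprL x) -(reprL y) !mulL_pi; apply/piLP.
exists (lev (repr x) * lev (repr y))%N; split => //=.
- exact: mul_lev_gt0.
- by rewrite mulnC.
move=> a aT; rewrite (mulnC (lev (repr y))) !normT_id ?mul_lev_gt0 //.
by rewrite mulrC.
Qed.

Lemma mulLA : associative mulL.
Proof.
move=> x y z; rewrite -(reprL x) -(reprL y) -(reprL z) !mulL_pi; apply/piLP.
set m1 := lev (repr x); set m2 := lev (repr y); set m3 := lev (repr z).
have m10 : (0 < m1)%N := lev_gt0 _; have m20 : (0 < m2)%N := lev_gt0 _.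
have m30 : (0 < m3)%N := lev_gt0 _.
exists (m1 * m2 * m3)%N; split; rewrite /= -/m1 -/m2 -/m3.
- by rewrite !muln_gt0 m10 m20.
- by rewrite mulnA.
- by [].
move=> a aT.
rewrite !normT_comp ?muln_gt0 ?m10 ?m20 ?m30 ?mulrA ?mulnA //;
  by [exact: dvdn_mulr | exact: dvdn_mull |
      rewrite -mulnA; first [exact: dvdn_mulr | exact: dvdn_mull] |
      rewrite mulnAC; exact: dvdn_mull].
Qed.

Lemma mul1L : left_id oneL mulL.
Proof.
move=> x; rewrite -(reprL x) mulL_pi; apply/piLP.
exists (lev (repr x)); split; rewrite /= ?mul1n ?lev_gt0 // => a aT.
by rewrite mul1r !normT_id ?lev_gt0.
Qed.

HB.instance Definition _ :=
  Monoid.isComLaw.Build L oneL mulL mulLA mulLC mul1L.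

Definition Theta : set (set L) := [set iorbit frobL xi | xi in [set: L]].

(* The value xi(a)_m at a in T_m of an element xi of L_m, seen as a character
   of T_m; it is 0 if xi does not come from a character of T_m. *)
Definition valL (xi : L) (m : nat) (a : K) : C :=
  xget 0 [set c | exists x : lchar, [/\ lev x = m, piL x = xi & c = x a]].

Definition omegaL (la : mpartn L) : L :=
  \big[mulL/oneL]_(phi <- finsupp la)
    \big[mulL/oneL]_(xi \in phi) expL xi (psize (la phi)).

End DirectLimit.

Section SymmetricPolynomials.

Variable C : fieldType.

Definition psum (N k : nat) : {mpoly C[N]} := \sum_(i < N) 'X_i ^+ k.

(* The Schur polynomial s_la(x_1, ..., x_N), as a quotient of alternants. *)
Definition schur (la : partn) (N : nat) : {mpoly C[N]} :=
  if (size la <= N)%N then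
    xget 0 [set s : {mpoly C[N]} |
      s * \det (\matrix_(i < N, j < N) 'X_i ^+ (N - j.+1)) =
      \det (\matrix_(i < N, j < N) 'X_i ^+ (nth 0%N la j + (N - j.+1)))]
  else 0.

(* The expression of the Schur function s_la as a polynomial in the power sums
   p_1, ..., p_|la|, the variable of index i standing for p_(i+1). *)
Definition schur_psum (la : partn) : {mpoly C[psize la]} :=
  xget 0 [set Q : {mpoly C[psize la]} |
    forall N, Q \mPo [tuple psum N i.+1 | i < psize la] = schur la N].

Definition hl_v (m : nat) (t : C) : C :=
  \prod_(1 <= i < m.+1) ((1 - t ^+ i) / (1 - t)).

(* v_la(t), la being padded with zeros to length N. *)
Definition hl_vla (la : partn) (N : nat) (t : C) : C :=
  hl_v (N - size la) t * \prod_(i <- undup la) hl_v (count_mem i la) t.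

Definition hl_sum (la : partn) (t : C) (N : nat) : {fraction {mpoly C[N]}} :=
  let x (i : 'I_N) := tofrac ('X_i : {mpoly C[N]}) in
  \sum_(w : {perm 'I_N})
    (\prod_(i < N) x (w i) ^+ nth 0%N la i) *
    \prod_(i < N) \prod_(j < N | (i < j)%N)
      ((x (w i) - tofrac (t%:MP) * x (w j)) / (x (w i) - x (w j))).

(* The Hall-Littlewood polynomial P_la(x_1, ..., x_N; t): the symmetrized sum
   above, which is a polynomial, divided by v_la(t). *)
Definition hall_littlewood (la : partn) (t : C) (N : nat) : {mpoly C[N]} :=
  if (size la <= N)%N then
    xget 0 [set p : {mpoly C[N]} |
      tofrac ((hl_vla la N t) *: p) = hl_sum la t N]
  else 0.

End SymmetricPolynomials.

(* The ring of symmetric functions in infinitely many variables is the limit of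
   the rings of symmetric polynomials in N variables. An identity between
   symmetric functions in the X^(f) is thus stated for all N, after setting
   X_i^(f) = 0 for i >= N: it lives in [Xring N], the polynomial ring in the
   variables X_i^(f), i < N. *)
Section Characteristic.

Variables (K : fieldType) (C : fieldType) (q : nat).

Definition Xring (N : nat) := monalg.malg (monalg.cmonom (set K * 'I_N)%type) C.

Definition Xvar (N : nat) (f : set K) (i : 'I_N) : Xring N :=
  monalg.mkmalgU (monalg.ucm (f, i)) 1.

Definition psumX (N : nat) (f : set K) (k : nat) : Xring N :=
  \sum_(i < N) Xvar f i ^+ k.

Definition hlX (N : nat) (mu : mpartn K) : Xring N :=
  ((- q%:R) ^- mpn mu : C) *:
  \prod_(f <- finsupp mu)
    mmap (fun c : C => c%:A) (@Xvar N f)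
      (hall_littlewood (mu f) ((- q%:R) ^- ocard f) N).

(* The choice of xi in phi is immaterial. *)
Definition psumY (N : nat) (phi : set (L K C q)) (k : nat) : Xring N :=
  let xi := xget (oneL K C q) phi in
  let m := (k * ocard phi)%N in
  (-1) ^+ m.-1 *: \sum_(a \in @Tm K q m)
    (valL xi m a *:
      let d := ocard (iorbit (Frob q) a) in
      if (d %| m)%N then psumX N (iorbit (Frob q) a) (m %/ d) else 0).

Definition schurY (N : nat) (la : mpartn (L K C q)) : Xring N :=
  \prod_(phi <- finsupp la)
    mmap (fun c : C => c%:A) (fun i => psumY N phi i.+1)
      (schur_psum C (la phi)).

Definition chi_values (n : nat) (la : mpartn (L K C q)) (c : mpartn K -> C)
    : Prop :=
  forall N : nat,
    (-1) ^+ (n./2 + mpn la) *: schurY N la =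
    \sum_(mu \in mparts (@Phi K q) n) (c mu *: hlX N mu).

End Characteristic.

Section UnitaryGroup.

Variables (K : fieldType) (C : fieldType) (q n : nat).

Definition unitary : set 'M[K]_n :=
  [set g | g \in unitmx /\
           invmx (map_mx (fun x => x ^+ q) g)^T = g].

Definition jordan_block (a : K) (k : nat) : 'M[K]_k :=
  \matrix_(i, j) (a *+ (i == j) + (i.+1 == j :> nat)%:R).

(* s lists the pairs (eigenvalue, size) of the Jordan blocks of g. *)
Definition jordan_blocks (g : 'M[K]_n) (s : seq (K * nat)) : Prop :=
  let J := \mxdiag_(i < size s)
    jordan_block (nth (0, 0%N) s i).1 (nth (0, 0%N) s i).2 in
  all (fun b => (0 < b.2)%N) s /\
  exists P, [/\ row_free P, row_full P & P *m g = J *m P].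

Definition uclass (mu : mpartn K) : set 'M[K]_n :=
  [set g | unitary g /\ exists2 s, jordan_blocks g s &
    forall a, a != 0 ->
      perm_eq [seq b.2 | b <- s & b.1 == a] (mu (iorbit (Frob q) a))].

(* chi is the class function chi^la; only its values on the unitary group are
   meaningful, and they are determined because the functions [hlX N mu], for mu
   in [mparts (Phi q) n] and N large, are linearly independent. *)
Definition is_chi (la : mpartn (L K C q)) (chi : 'M[K]_n -> C) : Prop :=
  exists2 c : mpartn K -> C, chi_values n la c &
    forall mu, mparts (@Phi K q) n mu ->
      forall g, uclass mu g -> chi g = c mu.

End UnitaryGroup.

(* Main.v *)
Require Import Defs.
From HB Require Import structures.
From mathcomp Require Import all_boot all_order all_algebra perm.
From mathcomp Require Import finmap boolp classical_sets functions cardinality.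
From mathcomp Require Import fsbigop reals complex.
From mathcomp Require monalg.
Import -(notations) monalg.
From mathcomp Require Import mpoly.
From mathcomp Require Import ring zify.
(* So that partn denotes partitions, and not the p-part of a number. *)
Import Defs.

Set Implicit Arguments.
Unset Strict Implicit.
Unset Printing Implicit Defensive.

Import Order.TTheory GRing.Theory Num.Theory.

Local Open Scope classical_set_scope.
Local Open Scope ring_scope.

(** The identity that defines chi^la is evaluated at the points X^({al}) = v,
    X^(f) = 0 for f <> {al}, where al is in T_1 and v has N coordinates; the
    values at al = alpha and at al = 1 are then compared.

    The Schur side.  In p_k(Y^(phi)) only the term of al survives, and it equals
    +-xi(al)_m p_m(v) with m = k |phi|.  As al is fixed by F, its norm from T_m
    to T_|phi| is al^k, so xi(al)_m is the k-th power of c = xi(al)_|phi|.  The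
    Schur function s_mu is homogeneous of weight |mu| in the power sums, which
    is read on the Jacobi-Trudi determinant [schur_psum_det], so that the factor
    of phi is c^|la^(phi)| times a quantity independent of al.  The product of
    these powers is omega_la(al)_1 ([Theta_represents]): the product of the
    characters of an orbit is the restriction of xi to T_1 composed with the
    norm.  This gives [eval_schurY].  To make sense of xi(al)_m one needs that an
    element of L fixed by F^m comes from T_m; as K is algebraically closed, the
    surjectivity of the norm and Hilbert's theorem 90 are obtained by extracting
    roots ([normT_surj], [normT_ker], [represents_descent]).

    The Hall-Littlewood side.  P_mu vanishes at such a point unless mu is
    supported on {al}, so that the sum runs over the partitions nu of n
    ([chi_values_center]).  Writing d_nu for the difference between the value of
    chi^la at the class of type nu with eigenvalue alpha and omega_la(alpha)_1
    times its value at the class of type nu with eigenvalue 1, it follows that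
    the sum of d_nu (-q)^(-n(nu)) P_nu(v; t) vanishes for all v, with t = -1/q.
    At v = (t^(N-1), ..., t, 1) a single permutation contributes to the
    symmetrised sum defining P_nu, and the value is a polynomial in z = t^N of
    degree the number of parts of nu ([hl_polyE]).  The relation holds for
    infinitely many z, and its coefficient of degree n only involves the
    partition (1^n): so d_nu = 0 for nu = (1^n), the type of the scalar
    matrices ([hl_separate]).

    Both sides are given by objects characterised by a property, hence the two
    existence results: a skew-symmetrised polynomial is divisible by the
    Vandermonde product ([skew_div]), and Schur polynomials are polynomials in
    the power sums, uniformly in the number of variables ([schur_psum_spec]);
    both rest on the factorisation of alternants [jacobi_trudi].  Moreover the
    sum over mu is infinite a priori, and such a sum is 0 when its support is
    infinite; this is excluded because the Schur side does not vanish
    identically ([schur_center_neq0]): the power sums of v may be prescribed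
    ([power_sums_onto]). *)

(** * Newton's relations *)

Section Newton.

Variable A : idomainType.
Hypothesis natA : forall k, k.+1%:R != 0 :> A.

(** With z_i standing for p_(i+1), the relations between the power sums and the
    complete symmetric functions u_k. *)
Definition newton_rel (z u : nat -> A) :=
  u 0%N = 1 /\ forall k, u k.+1 *+ k.+1 = \sum_(i < k.+1) z (k - i)%N * u i.

Lemma mulIrS k (x y : A) : x *+ k.+1 = y *+ k.+1 -> x = y.
Proof. by rewrite -(mulr_natr x) -(mulr_natr y) => /(mulIf (natA k)). Qed.

Lemma newton_eq n z z' u u' : newton_rel z u -> newton_rel z' u' ->
  (forall i, (i < n)%N -> z i = z' i) -> forall k, (k <= n)%N -> u k = u' k.
Proof.
move=> [u0 uS] [u'0 u'S] zz'; elim/ltn_ind => -[|k] IH kn; first by rewrite u0 u'0.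
apply: (@mulIrS k); rewrite uS u'S; apply: eq_bigr => -[i /= ik] _.
by rewrite zz' ?IH //; lia.
Qed.

Lemma newton_inj n z z' u u' : newton_rel z u -> newton_rel z' u' ->
  (forall k, (k <= n)%N -> u k = u' k) -> forall i, (i < n)%N -> z i = z' i.
Proof.
move=> [u0 uS] [u'0 u'S] uu'; elim/ltn_ind => k IH kn.
have := uS k; rewrite uu' // u'S !big_ord_recl /= !subn0 uu' // u'0 !mulr1.
rewrite [X in _ = _ + X](eq_bigr (fun i : 'I_k => z' (k - bump 0 i)%N * u' (bump 0 i))).
  by move/addIr.
move=> [i /= ik] _; have b : bump 0 i = i.+1 by [].
by rewrite !b IH ?uu' //; lia.
Qed.

Lemma coefM_trunc (p p' r : {poly A}) k :
  (forall i, (i <= k)%N -> p`_i = p'`_i) -> (p * r)`_k = (p' * r)`_k.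
Proof.
by move=> pp'; rewrite !coefM; apply: eq_bigr => i _; rewrite pp' // -ltnS.
Qed.

(** The relations say that U' = Z U and V' = - Z V for the generating series,
    so that (U V)' = 0. *)
Lemma newton_conv z u v : newton_rel z u -> newton_rel (fun i => - z i) v ->
  forall k, \sum_(i < k.+1) v i * u (k - i)%N = (k == 0%N)%:R.
Proof.
move=> [u0 uS] [v0 vS] [|k]; first by rewrite big_ord1 u0 v0 mulr1.
pose P (w : nat -> A) := \poly_(i < k.+2) w i.
have coefP w i : (i <= k.+1)%N -> (P w)`_i = w i.
  by move=> ik; rewrite coef_poly ltnS ik.
have dP w y : (forall j, w j.+1 *+ j.+1 = \sum_(i < j.+1) y (j - i)%N * w i) ->
    forall i, (i <= k)%N -> (P w)^`()`_i = (P w * P y)`_i.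
  move=> wS i ik; rewrite coef_deriv coefP // wS coefM; apply: eq_bigr => -[j /= ji] _.
  by rewrite !coefP ?(mulrC (y _)) //; lia.
have /= : (P v * P u)^`()`_k = 0.
  rewrite derivM coefD (coefM_trunc _ (dP v (fun i => - z i) vS)) [P v * _^`()]mulrC.
  rewrite (coefM_trunc _ (dP u z uS)) -coefD.
  have -> : P (fun i => - z i) = - P z.
    by apply/polyP => i; rewrite coefN !coef_poly; case: ifP; rewrite ?oppr0.
  suff -> : P v * - P z * P u + P u * P z * P v = 0 by rewrite coef0.
  by ring.
rewrite coef_deriv => E0; have : (P v * P u)`_k.+1 = 0.
  by apply: (@mulIrS k); rewrite mul0rn.
rewrite coefM => E; rewrite -[RHS]E.
by apply: eq_bigr => -[i /= ik] _; rewrite !coefP //; lia.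
Qed.

(** Reversed so that its coefficients are (-1)^k e_k; those of
    [\prod_(x <- s) ('X - x%:P)] come in the opposite order. *)
Definition elemp (s : seq A) : {poly A} := \prod_(x <- s) (1 - x *: 'X).

Lemma coef_1subX (x : A) p k :
  ((1 - x *: 'X) * p)`_k = p`_k - (if k is j.+1 then x * p`_j else 0).
Proof.
rewrite mulrBl mul1r coefB -scalerAl coefZ coefXM.
by case: k => [|k] //=; rewrite mulr0.
Qed.

Lemma coef0_elemp (s : seq A) : (elemp s)`_0 = 1.
Proof.
rewrite /elemp; elim: s => [|x s IH]; first by rewrite big_nil coef1.
by rewrite big_cons coef_1subX IH subr0.
Qed.

Lemma size_elemp (s : seq A) : (size (elemp s) <= (size s).+1)%N.
Proof.
elim: s => [|y s IH]; first by rewrite /elemp big_nil size_poly1.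
have -> : elemp (y :: s) = (1 - y *: 'X) * elemp s by rewrite /elemp big_cons.
have sz2 : (size ((1 : {poly A}) - y *: 'X)%R <= 2)%N.
  apply: (leq_trans (size_polyD _ _)); rewrite geq_max size_poly1 size_polyN.
  by rewrite (leq_trans (size_scale_leq _ _)) // size_polyX.
apply: (leq_trans (size_polyMleq _ _)); rewrite -subn1.
by rewrite (leq_trans (leq_sub2r 1 (leq_add sz2 IH))).
Qed.

Lemma elemp_newton (s : seq A) :
  newton_rel (fun i => - \sum_(x <- s) x ^+ i.+1) (fun k => (elemp s)`_k).
Proof.
split=> [|k]; first exact: coef0_elemp.
pose Z (t : seq A) : {poly A} := \poly_(i < k.+1) \sum_(x <- t) x ^+ i.+1.
suff H : forall i, (i <= k)%N -> (elemp s)^`()`_i = - (elemp s * Z s)`_i.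
  rewrite -coef_deriv H // coefM -sumrN; apply: eq_bigr => -[i /= ik] _.
  by rewrite coef_poly; case: ltnP => [|]; [rewrite mulNr mulrC | lia].
elim: s => [|x s IH] i ik.
  rewrite /elemp big_nil derivE coef0 mul1r coef_poly big_nil.
  by case: ifP; rewrite oppr0.
have -> : elemp (x :: s) = (1 - x *: 'X) * elemp s by rewrite /elemp big_cons.
pose G : {poly A} := \poly_(j < k.+1) x ^+ j.+1.
have -> : Z (x :: s) = G + Z s.
  by apply/polyP => j; rewrite coefD !coef_poly big_cons; case: ifP; rewrite ?addr0.
have -> : (1 - x *: 'X) * elemp s * (G + Z s) =
   ((1 - x *: 'X) * G) * elemp s + elemp s * Z s * (1 - x *: 'X) by ring.
rewrite derivM coefD.
have -> : (1 - x *: 'X)^`() = - x%:P :> {poly A}.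
  by rewrite derivB derivZ derivX derivC sub0r alg_polyC.
have HG j : (j <= i)%N -> ((1 - x *: 'X) * G)`_j = (x%:P)`_j.
  have GE l : (l <= i)%N -> G`_l = x ^+ l.+1.
    by move=> li; rewrite coef_poly ltnS (leq_trans li ik).
  case: j => [|j] ji; rewrite coef_1subX coefC ?GE //= ?subr0 ?expr1 //; last lia.
  by rewrite -exprS subrr.
rewrite coefD (coefM_trunc _ HG) opprD; congr (_ + _).
  by rewrite mulNr coefN.
rewrite mulrC -coefN -mulNr; apply: coefM_trunc => j ji.
by rewrite coefN IH //; lia.
Qed.

End Newton.

(** * The Jacobi-Trudi identity *)

Section JacobiTrudi.

Variables (A : idomainType) (N : nat) (x : 'I_N -> A) (u : nat -> A).

(** Entries of Jacobi-Trudi matrices; symmetric functions of negative degree are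
    zero. *)
Definition hsub (u : nat -> A) (m d : nat) : A := if (d <= m)%N then u (m - d)%N else 0.

Let els := elemp [seq x i | i <- index_enum 'I_N].
Let els_but i := elemp [seq x j | j <- index_enum 'I_N & j != i].

Hypothesis els_u : forall k, \sum_(i < k.+1) els`_i * u (k - i)%N = (k == 0%N)%:R.

Lemma elemp_but i : els = (1 - x i *: 'X) * els_but i.
Proof.
rewrite /els /els_but /elemp !big_map big_filter.
by rewrite (bigD1 i).
Qed.

Lemma size_elemp_but i : (size (els_but i) <= N)%N.
Proof.
apply: (leq_trans (size_elemp _)); rewrite size_map size_filter.
have := count_predC (pred1 i) (index_enum 'I_N).
rewrite (count_uniq_mem _ (index_enum_uniq _)) mem_index_enum.
by rewrite -[index_enum _]enumT size_enum_ord add1n => E; rewrite -[leqRHS]E.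
Qed.

(** 1 / (1 - x_i T) is the generating series of u times the product of the
    other factors 1 - x_j T. *)
Lemma exp_conv i m : x i ^+ m = \sum_(r < m.+1) (els_but i)`_r * u (m - r)%N.
Proof.
have u0 : u 0%N = 1.
  by have := els_u 0; rewrite big_ord1 coef0_elemp mul1r.
elim: m => [|m IH]; first by rewrite big_ord1 u0 coef0_elemp mulr1.
apply/eqP; rewrite exprS -subr_eq0 IH; apply/eqP.
have := els_u m.+1; rewrite (elemp_but i).
under eq_bigr do rewrite coef_1subX mulrBl.
rewrite sumrB => /eqP; rewrite subr_eq0 => /eqP ->.
rewrite [X in _ - X]big_ord_recl mul0r add0r.
rewrite mulr_sumr -sumrB big1 // => r _.
by rewrite lift0 subSS mulrA subrr.
Qed.

Definition hmx (b : 'I_N -> nat) : 'M[A]_N :=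
  \matrix_(k, j) hsub u (b j) (N - k.+1).

Lemma alternant_factor (b : 'I_N -> nat) :
  \matrix_(i, j) x i ^+ b j =
  (\matrix_(i, k) (els_but i)`_(N - k.+1)) *m hmx b.
Proof.
apply/matrixP => i j; rewrite !mxE exp_conv.
rewrite [RHS](reindex_inj rev_ord_inj) /=.
under [RHS]eq_bigr => k _.
  rewrite !mxE /= (_ : (N - (N - k.+1).+1 = k)%N).
    over.
  by case: k => k kN /=; lia.
rewrite -(big_mkord xpredT (fun k => (els_but i)`_k * hsub u (b j) k)).
rewrite -(big_mkord xpredT (fun k => (els_but i)`_k * u (b j - k)%N)).
set M := maxn N (b j).+1.
transitivity (\sum_(0 <= k < M) (els_but i)`_k * hsub u (b j) k).
  rewrite (@big_cat_nat _ _ _ (b j).+1 0 M) ?leq_maxr //=.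
  rewrite [X in _ = _ + X]big_nat [X in _ = _ + X]big1 ?addr0.
    by apply: eq_big_nat => k /andP[_]; rewrite ltnS /hsub => ->.
  by move=> k /andP[bk _]; rewrite /hsub leqNgt bk mulr0.
rewrite (@big_cat_nat _ _ _ N 0 M) ?leq_maxl //=.
rewrite [X in _ + X = _]big_nat [X in _ + X = _]big1 ?addr0 // => k /andP[Nk _].
by rewrite nth_default ?mul0r // (leq_trans (size_elemp_but i)).
Qed.

Lemma hmx_stair : \det (hmx (fun j => (N - j.+1)%N)) = 1.
Proof.
have u0 : u 0%N = 1.
  by have := els_u 0; rewrite big_ord1 coef0_elemp mul1r.
rewrite det_trig.
  by rewrite big1 // => i _; rewrite mxE /hsub leqnn subnn u0.
apply/is_trig_mxP => i j ij; rewrite mxE /hsub; case: leqP => //.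
by have := ltn_ord i; have := ltn_ord j; lia.
Qed.

(** Both determinants factor through the same matrix of elementary symmetric
    functions, and the second one is its determinant. *)
Lemma jacobi_trudi (b : 'I_N -> nat) :
  \det (\matrix_(i, j) x i ^+ b j) =
  \det (hmx b) * \det (\matrix_(i, j < N) x i ^+ (N - j.+1)).
Proof. by rewrite !alternant_factor !det_mulmx hmx_stair mulr1 mulrC. Qed.

End JacobiTrudi.

(** * Power sums *)

Section PowerSums.

Variable C : numClosedFieldType.

Lemma natC_neq0 k : k.+1%:R != 0 :> C.
Proof. by rewrite pnatr_eq0. Qed.

Lemma nat_mpoly_neq0 n k : k.+1%:R != 0 :> {mpoly C[n]}.
Proof. by rewrite -(rmorph_nat (@mpolyC n C)) mpolyC_eq0 pnatr_eq0. Qed.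

(** The list of the first k + 1 terms of the sequence determined by Newton's
    relations: the recursion involves all preceding terms. *)
Fixpoint newton_list (A : lalgType C) (z : nat -> A) (k : nat) : seq A :=
  if k is k'.+1 then
    let s := newton_list z k' in
    rcons s (k%:R^-1 *: \sum_(i < k) z (k' - i)%N * nth 0 s i)
  else [:: 1].

Definition newton (A : lalgType C) (z : nat -> A) (k : nat) : A :=
  nth 0 (newton_list z k) k.

Lemma nth_newton_list (A : lalgType C) (z : nat -> A) k i :
  (i <= k)%N -> nth 0 (newton_list z k) i = newton z i.
Proof.
have sz l : size (newton_list z l) = l.+1.
  by elim: l => //= l; rewrite size_rcons => ->.
elim: k => [|k IH]; first by rewrite leqn0 => /eqP ->.
rewrite leq_eqVlt => /orP[/eqP -> //|ik].
by rewrite /= nth_rcons sz ik IH.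
Qed.

Lemma newtonS (A : lalgType C) (z : nat -> A) k :
  newton z k.+1 *+ k.+1 = \sum_(i < k.+1) z (k - i)%N * newton z i.
Proof.
have sz l : size (newton_list z l) = l.+1.
  by elim: l => //= l; rewrite size_rcons => ->.
rewrite {1}/newton /= nth_rcons sz ltnn eqxx -scaler_nat scalerA divff; last first.
  exact: natC_neq0.
by rewrite scale1r; apply: eq_bigr => i _; rewrite nth_newton_list // -ltnS.
Qed.

Lemma newton_rel_mpoly n (z : nat -> {mpoly C[n]}) : newton_rel z (newton z).
Proof. by split=> // k; exact: newtonS. Qed.

Lemma newton_relC (z : nat -> C) : newton_rel z (@newton C^o z).
Proof. by split=> // k; exact: (@newtonS C^o z k). Qed.

Lemma coef_elemp_rev (s : seq C) k : (k <= size s)%N ->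
  (\prod_(z <- s) ('X - z%:P))`_(size s - k) = (elemp s)`_k.
Proof.
elim: s k => [|z s IH] k ks.
  by move: ks; rewrite leqn0 => /eqP ->; rewrite /elemp !big_nil.
have -> : elemp (z :: s) = (1 - z *: 'X) * elemp s by rewrite /elemp big_cons.
rewrite big_cons coef_1subX mulrBl coefB coefXM coefCM /=.
have szP : size (\prod_(y <- s) ('X - y%:P)) = (size s).+1 by rewrite size_prod_XsubC.
case: k ks => [|k] ks.
  rewrite subn0 /= subr0 -(IH 0%N) // subn0.
  by rewrite [X in _ - z * X]nth_default ?mulr0 ?subr0 // szP.
rewrite subSS IH //; case: ifP => [k0|/negbT k0].
  by congr (_ - _); rewrite nth_default // (leq_trans (size_elemp s)) //.
by rewrite -(IH k.+1) ?subnS //; move: k0; rewrite subn_eq0 -ltnNge.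
Qed.

(** Newton's relations turn the prescribed power sums into the coefficients of
    a polynomial, and x lists its roots. *)
Lemma power_sums_onto n (y : nat -> C) :
  exists x : 'I_n -> C, forall k, (k < n)%N -> \sum_i x i ^+ k.+1 = y k.
Proof.
pose a : nat -> C := @newton C^o (fun i => - y i).
have aP : newton_rel (fun i => - y i) a by exact: newton_relC.
have a0 : a 0%N = 1 by case: aP.
pose P : {poly C} := \poly_(k < n.+1) a (n - k)%N.
have Pn : P`_n = 1 by rewrite coef_poly ltnSn subnn.
have szP : size P = n.+1.
  apply/eqP; rewrite eqn_leq size_poly /= ltnNge; apply/negP => h.
  by move: Pn => /eqP; rewrite nth_default // eq_sym oner_eq0.
have [r Pr] := closed_field_poly_normal P.
move: Pr; rewrite lead_coefE szP Pn scale1r => Pr.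
have szr : size r = n.
  by have := szP; rewrite Pr size_prod_XsubC => -[].
exists (fun i => nth 0 r i) => k kn.
have E i : (i <= n)%N -> (elemp r)`_i = a i.
  move=> ile; rewrite -coef_elemp_rev ?szr // -Pr coef_poly ltnS leq_subr.
  by rewrite subKn.
have := newton_inj (elemp_newton r) aP E kn; move/oppr_inj => <-.
by rewrite (big_nth 0) szr big_mkord.
Qed.

End PowerSums.

(** * Schur functions as polynomials in the power sums *)

Section Partitions.

Variable la : partn.

Lemma partn_nth_le i j : (i <= j)%N -> (nth 0 la j <= nth 0 la i)%N.
Proof.
move=> ij; case: (ltnP j (size la)) => jl; last by rewrite nth_default.
have /andP[so _] := partsP la; apply: (sorted_leq_nth _ _ 0%N so) => //.
- by move=> a b c; rewrite /geq /=; lia.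
- exact: leqnn.
- exact: leq_ltn_trans jl.
Qed.

Lemma partn_gt0 j : (j < size la)%N -> (0 < nth 0 la j)%N.
Proof.
have /andP[_ n0] := partsP la => jl; rewrite lt0n.
by apply: contraNN n0 => /eqP <-; exact: mem_nth.
Qed.

Lemma nth_size_sumn (s : seq nat) j : all (leq 1) s -> (j < size s)%N ->
  (nth 0 s j + size s <= (sumn s).+1)%N.
Proof.
have szs t : all (leq 1) t -> (size t <= sumn t)%N.
  by elim: t => //= a t IH /andP[a0 /IH]; lia.
elim: s j => //= a s IH [|j] /andP[a0 as0] /=; first by have := szs _ as0; lia.
by rewrite ltnS => /(IH j as0); lia.
Qed.

Lemma partn_all_gt0 : all (leq 1) la.
Proof.
have /andP[_ n0] := partsP la; apply/allP => a al; rewrite lt0n.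
by apply: contraNN n0 => /eqP <-.
Qed.

Lemma size_partn : (size la <= psize la)%N.
Proof.
case: (posnP (size la)) => [-> //|l0].
by have := nth_size_sumn partn_all_gt0 l0; have := partn_gt0 l0; rewrite /psize; lia.
Qed.

(** Hook lengths are at most |la|: the entries of the Jacobi-Trudi matrix only
    involve p_1, ..., p_|la|. *)
Lemma partn_hook j k : (j < size la)%N -> (k < size la)%N ->
  (nth 0 la j + k - j <= psize la)%N.
Proof. by move=> jl; have := nth_size_sumn partn_all_gt0 jl; rewrite /psize; lia. Qed.

End Partitions.

Section Schur.

Variable C : numClosedFieldType.

Definition psum_var n (i : nat) : {mpoly C[n]} :=
  if insub i is Some j then 'X_(j : 'I_n) else 0.

(** Complete homogeneous symmetric functions, as polynomials in the power sums
    p_1, ..., p_n and in N variables respectively. *)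
Definition hpoly n k : {mpoly C[n]} := newton (psum_var n) k.

Definition hsym N k : {mpoly C[N]} := newton (fun i => psum C N i.+1) k.

Lemma hpoly_psum n N k : (k <= n)%N ->
  hpoly n k \mPo [tuple psum C N i.+1 | i < n] = hsym N k.
Proof.
set t := [tuple _ | i < n] => kn.
have [h0 hS] := newton_rel_mpoly (psum_var n).
have R : newton_rel (fun i => psum_var n i \mPo t) (fun k => hpoly n k \mPo t).
  split=> [|l]; first by rewrite /hpoly h0 comp_mpoly1.
  by rewrite -comp_mpolyMn hS rmorph_sum; apply: eq_bigr => i _; rewrite rmorphM.
apply: (newton_eq (@nat_mpoly_neq0 C N) R (newton_rel_mpoly _) _ kn) => i iln.
by rewrite /psum_var insubT comp_mpolyXU -tnth_nth tnth_mktuple.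
Qed.

Lemma hpoly_eval n (y : nat -> C) : newton_rel
  (fun i => if (i < n)%N then y i else 0) (fun k => (hpoly n k).@[fun i => y i]).
Proof.
have [h0 hS] := newton_rel_mpoly (psum_var n).
split=> [|l]; first by rewrite /hpoly h0 meval1.
rewrite -mevalMn hS rmorph_sum; apply: eq_bigr => i _; rewrite rmorphM /=.
congr (_ * _); rewrite /psum_var.
by case: insubP => [j -> <-|/negPf ->]; rewrite ?mevalXU ?meval0.
Qed.

Lemma hpoly_scale n (y : nat -> C) (c : C) k :
  (hpoly n k).@[fun i => c ^+ i.+1 * y i] = c ^+ k * (hpoly n k).@[fun i => y i].
Proof.
have [h0 hS] := hpoly_eval n y.
have R : newton_rel (fun i => if (i < n)%N then c ^+ i.+1 * y i else 0)
    (fun k => c ^+ k * (hpoly n k).@[fun i => y i]).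
  split=> [|l]; first by rewrite h0 mulr1.
  rewrite -mulrnAr hS mulr_sumr; apply: eq_bigr => -[i /= il] _.
  have -> : c ^+ l.+1 = c ^+ (l - i).+1 * c ^+ i by rewrite -exprD; congr (_ ^+ _); lia.
  by case: ifP => _; rewrite ?mul0r ?mulr0 // mulrACA.
exact: (newton_eq (@natC_neq0 C) (hpoly_eval n (fun i => c ^+ i.+1 * y i)) R
  (n := k)).
Qed.

Lemma hsym_conv N k : \sum_(i < k.+1)
  (elemp [seq ('X_i : {mpoly C[N]}) | i <- index_enum 'I_N])`_i * hsym N (k - i) =
  (k == 0%N)%:R.
Proof.
apply: (newton_conv (@nat_mpoly_neq0 C N) (newton_rel_mpoly _)).
have := elemp_newton [seq ('X_i : {mpoly C[N]}) | i <- index_enum 'I_N].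
by congr newton_rel; apply/funext => i; rewrite big_map.
Qed.

Definition alternant N (b : 'I_N -> nat) : {mpoly C[N]} :=
  \det (\matrix_(i, j) 'X_i ^+ b j).

Definition stair N (j : 'I_N) : nat := (N - j.+1)%N.

Lemma alternant_div N (b : 'I_N -> nat) :
  alternant b = \det (hmx (hsym N) b) * alternant (@stair N).
Proof. exact: jacobi_trudi (@hsym_conv N) b. Qed.

Lemma alternant_eval N (b : 'I_N -> nat) v :
  (alternant b).@[v] = \det (\matrix_(i, j) v i ^+ b j).
Proof.
rewrite /alternant -det_map_mx; congr (\det _).
by apply/matrixP => i j; rewrite !mxE rmorphXn /= mevalXU.
Qed.

(** At a geometric progression the alternant is a Vandermonde determinant in
    the values s^(b_j). *)
Lemma alternant_geom_neq0 N (s : C) (b : 'I_N -> nat) :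
  (forall i j, i != j -> s ^+ b i != s ^+ b j) ->
  (alternant b).@[fun i => s ^+ i] != 0.
Proof.
move=> sb; rewrite alternant_eval.
rewrite (_ : (\matrix_(_, _) _) = Vandermonde N (\row_j s ^+ b j)).
  rewrite det_Vandermonde; apply/prodf_neq0 => i _; apply/prodf_neq0 => j ij.
  by rewrite !mxE subr_eq0 sb // neq_ltn ij orbT.
by apply/matrixP => i j; rewrite !mxE -!exprM mulnC.
Qed.

Lemma exp2_inj : injective (fun n => 2%:R ^+ n : C).
Proof. by apply: ieexprIn; rewrite ?ltr0n // pnatr_eq1. Qed.

Lemma alternant_stair_neq0 N : alternant (@stair N) != 0.
Proof.
apply/eqP => E; have := @alternant_geom_neq0 N 2%:R (@stair N).
rewrite E meval0 eqxx => H; suff: false by [].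
apply: H => i j; apply: contraNN => /eqP/exp2_inj E'; apply/eqP/val_inj.
by case: i j E' => i ilt [j jlt]; rewrite /stair /=; lia.
Qed.

Variable la : partn.

Definition shifted N (j : 'I_N) : nat := (nth 0 la j + (N - j.+1))%N.

Lemma schurE N : (size la <= N)%N -> schur C la N = \det (hmx (hsym N) (@shifted N)).
Proof.
rewrite /schur => ->; apply: xget_unique; first exact: esym (alternant_div _).
move=> p /= pE; apply: (mulIf (alternant_stair_neq0 N)).
by rewrite -alternant_div; exact: pE.
Qed.

Definition jtmx (A : idomainType) (h : nat -> A) m : 'M[A]_m :=
  \matrix_(k, j) hsub h (nth 0%N la j + k) j.

Lemma hmx_shifted N : hmx (hsym N) (@shifted N) = jtmx (hsym N) N.
Proof.
apply/matrixP => -[k kN] [j jN]; rewrite !mxE /hsub /shifted /=.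
have -> : (N - k.+1 <= nth 0 la j + (N - j.+1))%N = (j <= nth 0 la j + k)%N by lia.
by case: leqP => // jk; congr (hsym N _); lia.
Qed.

Lemma det_jtmx_stable (A : idomainType) (h : nat -> A) N : h 0%N = 1 ->
  (size la <= N)%N -> \det (jtmx h N) = \det (jtmx h (size la)).
Proof.
move=> h0 /subnKC; move: (N - size la)%N => r <- {N}.
have -> : jtmx h (size la + r) = block_mx (jtmx h (size la)) 0
    (dlsubmx (jtmx h (size la + r))) (drsubmx (jtmx h (size la + r))).
  rewrite -[LHS]submxK; congr block_mx; apply/matrixP => k j; rewrite !mxE //=.
  rewrite /hsub nth_default ?leq_addr // add0n leqNgt ifF //.
  by apply/negbF; rewrite (leq_trans (ltn_ord k)) ?leq_addr.
rewrite det_lblock [X in _ * X]det_trig.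
  rewrite big1 ?mulr1 // => i _; rewrite !mxE /= /hsub nth_default ?leq_addr //.
  by rewrite leqnn subnn h0.
apply/is_trig_mxP => i j ij; rewrite !mxE /= /hsub nth_default ?leq_addr //.
by rewrite add0n leq_add2l leqNgt ij.
Qed.

(** With fewer variables than parts, e_k = 0 for k > N makes the rows of the
    matrix linearly dependent. *)
Lemma det_jtmx_few N : (N < size la)%N -> \det (jtmx (hsym N) (size la)) = 0.
Proof.
move=> Nl; apply/eqP/det0P; set l := size la.
set e := elemp [seq ('X_i : {mpoly C[N]}) | i <- index_enum 'I_N].
have sze : (size e <= l)%N.
  apply: (leq_trans (size_elemp _)); rewrite size_map.
  by rewrite -[index_enum _]enumT size_enum_ord.
exists (\row_(k < l) e`_(l - k.+1)).
  have l0 : (l.-1 < l)%N by rewrite prednK //; exact: leq_ltn_trans Nl.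
  apply/eqP => /rowP/(_ (Ordinal l0)); rewrite !mxE /=.
  have -> : (l - l.-1.+1 = 0)%N by lia.
  by rewrite coef0_elemp => /eqP; rewrite oner_eq0.
apply/rowP => j; rewrite !mxE.
rewrite (reindex_inj rev_ord_inj) /=.
under eq_bigr => k _.
  rewrite !mxE /= (_ : (l - (l - k.+1).+1 = k)%N); last by case: k => k kl /=; lia.
  over.
set M := (nth 0%N la j + l.-1 - j)%N.
have jl := ltn_ord j; have := partn_gt0 jl => lj.
have M0 : (0 < M)%N by rewrite /M; lia.
transitivity (\sum_(k < l) e`_k * hsub (hsym N) M k).
  apply: eq_bigr => -[k kl] _ /=; congr (_ * _); rewrite /hsub /M.
  have -> : (k <= nth 0 la j + l.-1 - j)%N = (j <= nth 0 la j + (l - k.+1))%N by lia.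
  by case: leqP => // jk; congr (hsym N _); lia.
have conv0 := hsym_conv N M; rewrite eqn0Ngt M0 in conv0; rewrite -[RHS]conv0 -/e.
rewrite -(big_mkord xpredT (fun k => e`_k * hsub (hsym N) M k)).
rewrite -(big_mkord xpredT (fun k => e`_k * hsym N (M - k)%N)).
set T := maxn l M.+1.
transitivity (\sum_(0 <= k < T) e`_k * hsub (hsym N) M k).
  rewrite (@big_cat_nat _ _ _ l 0 T) ?leq_maxl //=.
  rewrite [X in _ = _ + X]big_nat [X in _ = _ + X]big1 ?addr0 // => k /andP[Nk _].
  by rewrite nth_default ?mul0r // (leq_trans sze).
rewrite (@big_cat_nat _ _ _ M.+1 0 T) ?leq_maxr //=.
rewrite [X in _ + X = _]big_nat [X in _ + X = _]big1 ?addr0 => [|k /andP[bk _]].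
  by apply: eq_big_nat => k /andP[_]; rewrite ltnS /hsub => ->.
by rewrite /hsub leqNgt bk mulr0.
Qed.

Lemma schur_psum_spec N :
  schur_psum C la \mPo [tuple psum C N i.+1 | i < psize la] = schur C la N.
Proof.
suff [Q H] : exists Q : {mpoly C[psize la]}, forall N,
    Q \mPo [tuple psum C N i.+1 | i < psize la] = schur C la N.
  exact: (@xgetI _ 0 [set Q : {mpoly C[psize la]} | forall N,
    Q \mPo [tuple psum C N i.+1 | i < psize la] = schur C la N] Q H N).
exists (\det (jtmx (hpoly (psize la)) (size la))) => {}N.
set t := [tuple _ | i < _].
have -> : \det (jtmx (hpoly (psize la)) (size la)) \mPo t =
    \det (jtmx (hsym N) (size la)).
  rewrite -[LHS]/(comp_mpoly t _) -det_map_mx; congr (\det _).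
  apply/matrixP => k j; rewrite !mxE /hsub; case: ifP => _; last exact: comp_mpoly0.
  by rewrite /= hpoly_psum // partn_hook.
case: (leqP (size la) N) => lN; last by rewrite det_jtmx_few // /schur leqNgt lN.
by rewrite schurE // hmx_shifted det_jtmx_stable.
Qed.

Lemma meval_comp n N (p : {mpoly C[n]}) (t : n.-tuple {mpoly C[N]}) v :
  (p \mPo t).@[v] = p.@[fun i => (tnth t i).@[v]].
Proof.
rewrite comp_mpolyE mevalE -[LHS]/(meval v _) rmorph_sum; apply: eq_bigr => m _.
rewrite /= mevalZ rmorph_prod; congr (_ * _).
by apply: eq_bigr => i _; rewrite rmorphXn.
Qed.

Lemma meval_psum N (v : 'I_N -> C) k : (psum C N k).@[v] = \sum_j v j ^+ k.
Proof.
by rewrite /psum rmorph_sum; apply: eq_bigr => j _; rewrite rmorphXn /= mevalXU.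
Qed.

Lemma schur_psum_at N (v : 'I_N -> C) :
  (schur_psum C la).@[fun i => \sum_j v j ^+ i.+1] = (schur C la N).@[v].
Proof.
rewrite -schur_psum_spec meval_comp; apply: meval_eq => i.
by rewrite tnth_mktuple meval_psum.
Qed.

(** Any y is a vector of power sums, so that the Jacobi-Trudi formula, valid for
    every number of variables, determines the polynomial. *)
Lemma schur_psum_det (y : nat -> C) : (schur_psum C la).@[fun i => y i] =
  \det (jtmx (fun k => (hpoly (psize la) k).@[fun i => y i]) (size la)).
Proof.
have [v vy] := power_sums_onto (psize la) y.
have E (p : {mpoly C[psize la]}) :
    p.@[fun i => y i] = (p \mPo [tuple psum C (psize la) i.+1 | i < psize la]).@[v].
  by rewrite meval_comp; apply: meval_eq => i; rewrite tnth_mktuple meval_psum vy.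
rewrite E schur_psum_spec schurE ?size_partn // hmx_shifted.
rewrite det_jtmx_stable ?size_partn // -[LHS]/(meval v _) -det_map_mx; congr (\det _).
apply/matrixP => k j; rewrite !mxE /hsub; case: ifP => _; last exact: meval0.
by rewrite /= E hpoly_psum // partn_hook.
Qed.

(** The weight of h_(la_j - j + k) is la_j + k - j, so that the determinant is
    homogeneous: the powers c^j and c^k of the columns and rows cancel out. *)
Lemma schur_psum_scale (y : nat -> C) (c : C) : c != 0 ->
  (schur_psum C la).@[fun i => c ^+ i.+1 * y i] =
  c ^+ psize la * (schur_psum C la).@[fun i => y i].
Proof.
move=> c0; rewrite (schur_psum_det (fun i => c ^+ i.+1 * y i)) (schur_psum_det y).
set J := jtmx _ _; set J' := jtmx _ _.
set l := size la.
pose D : 'M[C]_l := diag_mx (\row_(k < l) c ^+ k).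
have D0 : \det D != 0.
  by rewrite det_diag; apply/prodf_neq0 => k _; rewrite mxE expf_neq0.
(* J has the entries c^(la_j + k - j) h_(la_j + k - j). *)
have E : J *m D = D *m J' *m diag_mx (\row_j c ^+ nth 0%N la j).
  rewrite mul_mx_diag mul_diag_mx mul_mx_diag.
  apply/matrixP => k j; rewrite !mxE /hsub; case: leqP => jk; last first.
    by rewrite !(mul0r, mulr0).
  rewrite hpoly_scale mulrAC -exprD subnK // mulrAC -exprD mulrC.
  by rewrite addnC mulrC.
apply: (mulIf D0); rewrite -det_mulmx E !det_mulmx [X in _ * X = _]det_diag.
have -> : \prod_(i < l) (\row_j c ^+ nth 0%N la j) 0 i = c ^+ psize la :> C.
  rewrite (eq_bigr (fun j : 'I_l => c ^+ nth 0%N la j)) => [|j _]; last by rewrite mxE.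
  by rewrite prodrXr /psize sumnE (big_nth 0%N) big_mkord.
by rewrite mulrC [\det D * _]mulrC mulrA.
Qed.

(** A quotient of alternants with distinct exponents is nonzero at the powers
    of 2. *)
Lemma schur_psum_neq0 : exists y : nat -> C, (schur_psum C la).@[fun i => y i] != 0.
Proof.
set l := size la; pose v (i : 'I_l) : C := 2%:R ^+ i.
exists (fun i => \sum_j v j ^+ i.+1); rewrite schur_psum_at schurE //.
have : (alternant (@shifted l)).@[v] != 0.
  apply: alternant_geom_neq0 => i j; apply: contraNN => /eqP/exp2_inj E.
  apply/eqP/val_inj; case: i j E => i il [j jl]; rewrite /shifted /=.
  by case: (ltngtP i j) => // ij; have := partn_nth_le la (ltnW ij); lia.
by rewrite alternant_div mevalM mulf_eq0 => /norP[].
Qed.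

End Schur.

(** * Nonvanishing of polynomials *)

Section InfinitePoints.

Variable C : numClosedFieldType.

Lemma poly_eq0_inf (p : {poly C}) (f : nat -> C) :
  injective f -> (forall k, p.[f k] = 0) -> p = 0.
Proof.
move=> finj p0; apply/eqP/negPn/negP => pn0.
have := max_poly_roots pn0 (rs := [seq f k | k <- iota 0 (size p)]).
rewrite size_map size_iota ltnn map_inj_uniq // iota_uniq => /(_ _ isT) H.
suff : false by []; apply: H; apply/allP => _ /mapP[k _ ->].
by apply/rootP.
Qed.

Lemma meval_line n (p : {mpoly C[n]}) (a b : 'I_n -> C) :
  exists r : {poly C}, forall c, r.[c] = p.@[fun i => a i + c * b i].
Proof.
exists (\sum_(m <- msupp p) p@_m *: \prod_i ((a i)%:P + b i *: 'X) ^+ m i) => c.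
rewrite mevalE horner_sum; apply: eq_bigr => m _.
rewrite hornerZ horner_prod; congr (_ * _); apply: eq_bigr => i _.
by rewrite horner_exp !hornerE mulrC.
Qed.

(** On the line through two points at which two polynomials do not vanish,
    their restrictions are nonzero polynomials in one variable. *)
Lemma meval_common_neq0 n (s : seq {mpoly C[n]}) :
  (forall p, p \in s -> exists v, p.@[v] != 0) ->
  exists v, (\prod_(p <- s) p).@[v] != 0.
Proof.
elim: s => [|p s IH] ps; first by exists (fun=> 0); rewrite big_nil meval1 oner_neq0.
have [v pv] := ps p (mem_head _ _).
have [|w sw] := IH; first by move=> r rs; apply: ps; rewrite inE rs orbT.
rewrite big_cons; set P := \prod_(_ <- _) _ in sw *.
have [r rE] := meval_line p v (fun i => w i - v i).
have [r' r'E] := meval_line P v (fun i => w i - v i).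
have r0 : r != 0.
  apply: contraNneq pv => r0; have := rE 0; rewrite r0 horner0 => ->.
  by apply/eqP/meval_eq => i; rewrite mul0r addr0.
have r'0 : r' != 0.
  apply: contraNneq sw => r'0; have := r'E 1; rewrite r'0 horner0 => ->.
  by apply/eqP/meval_eq => i; rewrite mul1r addrC subrK.
have [c cE] : exists c, (r * r').[c] != 0.
  apply: contrapT => /forallNP H; have /eqP := mulf_neq0 r0 r'0; apply.
  apply: (@poly_eq0_inf _ (fun k => k%:R)) => [|k].
    by move=> i j /eqP; rewrite eqr_nat => /eqP.
  by apply/eqP; have /negP := H k%:R; rewrite negbK.
exists (fun i => v i + c * (w i - v i)).
by rewrite mevalM -rE -r'E -hornerM.
Qed.

End InfinitePoints.

(** * Hall-Littlewood polynomials *)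

Section HallLittlewood.

Variable C : numClosedFieldType.
Implicit Types (la : partn) (t : C).

Definition pairprod (A : comPzRingType) N (F : 'I_N -> 'I_N -> A) : A :=
  \prod_(i < N) \prod_(j < N | (i < j)%N) F i j.

(** Read on Vandermonde determinants, where w permutes the columns. *)
Lemma pairprod_perm (A : comPzRingType) N (x : 'I_N -> A) (w : 'S_N) :
  pairprod (fun i j => x (w i) - x (w j)) =
  (-1) ^+ w * pairprod (fun i j => x i - x j).
Proof.
have E (y : 'I_N -> A) : pairprod (fun i j => y i - y j) =
    \det (Vandermonde N (\row_i - y i)).
  rewrite det_Vandermonde; apply: eq_bigr => i _; apply: eq_bigr => j _.
  by rewrite !mxE opprK addrC.
rewrite (E (x \o w)) E.
have -> : Vandermonde N (\row_i - (x \o w) i) =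
    col_perm w (Vandermonde N (\row_i - x i)).
  by apply/matrixP => i j; rewrite !mxE.
by rewrite col_permE det_mulmx det_perm mulrC odd_permV.
Qed.

Definition vdm N : {mpoly C[N]} := pairprod (fun i j => 'X_i - 'X_j).

Lemma alternant_stair_vdm N : exists e : {mpoly C[N]},
  alternant C (@stair N) = e * vdm N.
Proof.
pose rv : 'S_N := perm (@rev_ord_inj N).
exists ((-1) ^+ rv * pairprod (fun i j : 'I_N => -1)).
have -> : alternant C (@stair N) =
    \det (col_perm rv (Vandermonde N (\row_i ('X_i : {mpoly C[N]})))^T).
  congr (\det _); apply/matrixP => i j; rewrite !mxE.
  by rewrite permE.
rewrite col_permE det_mulmx det_perm odd_permV det_tr det_Vandermonde.
rewrite mulrC -mulrA; congr (_ * _); rewrite -big_split; apply: eq_bigr => i _.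
rewrite -big_split; apply: eq_bigr => j _.
by rewrite /= !mxE mulN1r opprB.
Qed.

Lemma vdm_neq0 N : vdm N != 0.
Proof.
have [e E] := alternant_stair_vdm N.
by have := alternant_stair_neq0 C N; rewrite E mulf_eq0 => /norP[].
Qed.

(** The symmetrised sum cleared of its denominators; the signs come from
    permuting the Vandermonde product. *)
Definition hl_num la t N : {mpoly C[N]} :=
  \sum_(w : 'S_N) (-1) ^+ w * ((\prod_i 'X_(w i) ^+ nth 0%N la i) *
    pairprod (fun i j => 'X_(w i) - t%:MP * 'X_(w j))).

Lemma hl_sum_num la t N : hl_sum la t N * tofrac (vdm N) = tofrac (hl_num la t N).
Proof.
rewrite /hl_sum mulr_suml rmorph_sum; apply: eq_bigr => w _.
set q := \prod_(i < N) \prod_(j < N | _) _.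
pose Vw : {mpoly C[N]} := pairprod (fun i j => 'X_(w i) - 'X_(w j)).
have VE : tofrac (vdm N) = (-1) ^+ w * tofrac Vw.
  rewrite /Vw (pairprod_perm (fun i => 'X_i : {mpoly C[N]})) rmorphM rmorph_sign.
  by rewrite mulrA -expr2 sqrr_sign mul1r.
have qE : q * tofrac Vw =
    tofrac (pairprod (fun i j => 'X_(w i) - t%:MP * 'X_(w j))).
  rewrite /pairprod /Vw !rmorph_prod -big_split; apply: eq_bigr => i _.
  rewrite !rmorph_prod -big_split; apply: eq_bigr => j ij.
  rewrite /= !rmorphB rmorphM /= divfK // -rmorphB tofrac_eq0 subr_eq0.
  apply/negP => /eqP/(congr1 (fun p : {mpoly C[N]} => p@_U_(w i)%MM)).
  rewrite !mcoeffX eqxx eq_mnm1 (inj_eq perm_inj) -val_eqE /= (gtn_eqF ij).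
  by move/eqP; rewrite oner_eq0.
have PE : \prod_(i < N) tofrac ('X_(w i) : {mpoly C[N]}) ^+ nth 0%N la i =
    tofrac (\prod_i 'X_(w i) ^+ nth 0%N la i).
  by rewrite rmorph_prod; apply: eq_bigr => i _; rewrite rmorphXn.
by rewrite VE PE !rmorphM rmorph_sign /= -qE mulrCA -!mulrA.
Qed.

(** A skew-symmetrised polynomial is a combination of alternants. *)
Lemma skew_div N (g : {mpoly C[N]}) : exists p : {mpoly C[N]},
  \sum_(w : 'S_N) (-1) ^+ w * (g \mPo [tuple 'X_(w i) | i < N]) = p * vdm N.
Proof.
have [e eE] := alternant_stair_vdm N.
exists (\sum_(m <- msupp g) g@_m *: (\det (hmx (@hsym C N) m) * e)).
under eq_bigr do rewrite comp_mpolyE mulr_sumr.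
rewrite exchange_big mulr_suml; apply: eq_bigr => m _.
rewrite -scalerAl -mulrA -eE -alternant_div.
rewrite /alternant -det_tr /(\det _) scaler_sumr; apply: eq_bigr => w _.
rewrite -scalerAr; congr (_ *: (_ * _)); apply: eq_bigr => i _.
by rewrite tnth_mktuple !mxE.
Qed.

Lemma hl_num_div la t N : exists p, hl_num la t N = p * vdm N.
Proof.
have [p pE] := skew_div ((\prod_(i < N) 'X_i ^+ nth 0%N la i) *
  pairprod (fun i j => 'X_i - t%:MP * 'X_j)).
exists p; rewrite -pE; apply: eq_bigr => w _; congr (_ * _).
rewrite rmorphM /= /pairprod !rmorph_prod /=; congr (_ * _).
  by apply: eq_bigr => i _; rewrite rmorphXn /= comp_mpolyXU -tnth_nth tnth_mktuple.
apply: eq_bigr => i _; rewrite rmorph_prod; apply: eq_bigr => j _.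
by rewrite /= rmorphB rmorphM /= comp_mpolyC !comp_mpolyXU -!tnth_nth !tnth_mktuple.
Qed.

Lemma hall_littlewood_num la t N : (size la <= N)%N -> hl_vla la N t != 0 ->
  hl_vla la N t *: hall_littlewood la t N * vdm N = hl_num la t N.
Proof.
move=> lN v0; have [p pE] := hl_num_div la t N.
have V0 : tofrac (vdm N) != 0 by rewrite tofrac_eq0 vdm_neq0.
have pS : tofrac p = hl_sum la t N.
  by apply: (mulIf V0); rewrite -rmorphM -pE hl_sum_num.
rewrite /hall_littlewood lN pE; congr (_ * _); apply/eqP.
rewrite -tofrac_eq pS; apply/eqP.
apply: (@xgetI _ 0 [set p0 : {mpoly C[N]} |
  tofrac (hl_vla la N t *: p0) = hl_sum la t N] ((hl_vla la N t)^-1 *: p)).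
by rewrite /= scalerA divff // scale1r.
Qed.

End HallLittlewood.

(** * Hall-Littlewood polynomials at a geometric progression *)

Section Principal.

Variables (C : numClosedFieldType) (t : C).
Hypothesis t0 : t != 0.
Hypothesis t_unit : forall k, (0 < k)%N -> t ^+ k != 1.
Implicit Type la : partn.

Lemma sub1t_neq0 k : (0 < k)%N -> 1 - t ^+ k != 0.
Proof. by move=> k0; rewrite subr_eq0 eq_sym t_unit. Qed.

Lemma expt_inj : injective (fun k => t ^+ k).
Proof.
move=> a b; wlog ab : a b / (a <= b)%N.
  by move=> H E; case: (leqP a b) => [/H->//|/ltnW/H->].
move=> /= E; apply/eqP; rewrite eqn_leq ab /= leqNgt; apply/negP => lab.
have := t_unit (k := b - a); rewrite subn_gt0 lab => /(_ isT) /eqP; apply.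
by apply: (mulIf (expf_neq0 a t0)); rewrite -exprD subnK // mul1r -E.
Qed.

Lemma hl_v_neq0 m : hl_v m t != 0.
Proof.
rewrite /hl_v big_nat prodf_seq_neq0; apply/allP => i _; apply/implyP => /andP[i0 _].
by rewrite mulf_neq0 ?invr_neq0 ?sub1t_neq0 // -(expr1 t) sub1t_neq0.
Qed.

Lemma hl_vla_neq0 la N : hl_vla la N t != 0.
Proof.
rewrite mulf_neq0 ?hl_v_neq0 // prodf_seq_neq0.
by apply/allP => i _; rewrite hl_v_neq0.
Qed.

Lemma hl_vS m : hl_v m.+1 t = hl_v m t * ((1 - t ^+ m.+1) / (1 - t)).
Proof. by rewrite /hl_v big_nat_recr. Qed.

Lemma pairprodS (A : comPzRingType) m (F : nat -> nat -> A) :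
  pairprod (fun i j : 'I_m.+1 => F i j) =
  pairprod (fun i j : 'I_m => F i j) * \prod_(i < m) F i m.
Proof.
rewrite /pairprod big_ord_recr /= [X in _ * X]big1 ?mulr1; last first.
  by move=> j; rewrite ltnNge -ltnS ltn_ord.
rewrite -big_split; apply: eq_bigr => i _.
by rewrite big_mkcond big_ord_recr /= ltn_ord -big_mkcond.
Qed.

Lemma eq_pairprod (A : comPzRingType) N (F G : 'I_N -> 'I_N -> A) :
  (forall i j : 'I_N, (i < j)%N -> F i j = G i j) -> pairprod F = pairprod G.
Proof.
by move=> FG; apply: eq_bigr => i _; apply: eq_bigr => j /FG.
Qed.

(** Going from m to m + 1 the product telescopes to (1 - t^(m+1)) / (1 - t). *)
Lemma pairprod_geom c m :
  pairprod (fun i j : 'I_m => c * t ^+ i - t * (c * t ^+ j)) =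
  hl_v m t * pairprod (fun i j : 'I_m => c * t ^+ i - c * t ^+ j).
Proof.
have u0 : 1 - t != 0 by rewrite -(expr1 t) sub1t_neq0.
elim: m => [|m IH]; first by rewrite /pairprod !big_ord0 /hl_v big_geq // mulr1.
rewrite (pairprodS m (fun i j => c * t ^+ i - t * (c * t ^+ j))).
rewrite (pairprodS m (fun i j => c * t ^+ i - c * t ^+ j)) IH hl_vS.
suff -> : \prod_(i < m) (c * t ^+ i - t * (c * t ^+ m)) =
    (1 - t ^+ m.+1) / (1 - t) * \prod_(i < m) (c * t ^+ i - c * t ^+ m).
  by rewrite mulrACA.
apply: (mulfI u0); rewrite [RHS]mulrA [(1 - t) * (_ / _)]mulrCA divff // mulr1.
clear IH; case: m => [|m]; first by rewrite !big_ord0 expr1.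
rewrite [in LHS]big_ord_recl [in RHS]big_ord_recr /=.
rewrite (eq_bigr (fun i : 'I_m => t * (c * t ^+ i - c * t ^+ m.+1))); last first.
  by move=> i _; rewrite /bump /= add1n exprS; ring.
rewrite big_split prodr_const card_ord /= expr0.
by rewrite !exprS; ring.
Qed.

(** At x_a = c t^(N-1-a), a permutation that does not reverse the order meets a
    factor x_a - t x_(a+1) = 0. *)
Lemma perm_rev N (w : 'S_N) :
  (forall i j : 'I_N, (i < j)%N -> (w j <> (w i).+1 :> nat)) ->
  forall i, w i = rev_ord i.
Proof.
move=> Hw; pose v a := w^-1%g a.
have vdec (a b : 'I_N) : b = a.+1 :> nat -> (v b < v a)%N.
  move=> ba; rewrite ltnNge leq_eqVlt; apply/negP => /orP[/eqP/val_inj/perm_inj E|].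
    by move: ba; rewrite E; lia.
  by move/Hw; rewrite !permKV.
(* v is decreasing, so that v a <= N - 1 - a and v a >= N - 1 - a. *)
have vhi k : forall a : 'I_N, a = k :> nat -> (v a + k < N)%N.
  elim: k => [|k IH] a ak; first by rewrite addn0.
  have kN : (k < N)%N by have := ltn_ord a; lia.
  have := IH (Ordinal kN) erefl; have := @vdec (Ordinal kN) a ak; lia.
have vlo k : forall a : 'I_N, (a + k.+1)%N = N -> (k <= v a)%N.
  elim: k => [//|k IH] a ak.
  have aN : (a.+1 < N)%N by lia.
  have H : (Ordinal aN + k.+1)%N = N by rewrite /=; lia.
  by have := IH (Ordinal aN) H; have := @vdec a (Ordinal aN) erefl; lia.
have vE a : v a = rev_ord a.
  apply/val_inj => /=; have al := ltn_ord a.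
  have := vhi a a erefl; have := vlo (N - a.+1)%N a; lia.
move=> i; have := vE (w i); rewrite /v permK => {2}->.
by rewrite rev_ordK.
Qed.

(** Only the permutation that reverses the order contributes to the numerator at
    the point (c t^(N-1), ..., c t, c), where its factors x_i - t x_j multiply to
    v_N(t) times the Vandermonde product. *)
Lemma hall_littlewood_geom la c N : c != 0 -> (size la <= N)%N ->
  hl_vla la N t * (hall_littlewood la t N).@[fun i => c * t ^+ (N - i.+1)] =
  hl_v N t * (c ^+ psize la * t ^+ pn la).
Proof.
move=> c0 lN.
set x := (fun i : 'I_N => _).
have xrev i : x (rev_ord i) = c * t ^+ i.
  by rewrite /x /=; congr (_ * _ ^+ _); have := ltn_ord i; lia.
pose rv : 'S_N := perm (@rev_ord_inj N).
have rvE i : rv i = rev_ord i by rewrite permE.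
have := congr1 (meval x) (hall_littlewood_num lN (hl_vla_neq0 la N)).
rewrite mevalM mevalZ.
have pairE (F : 'I_N -> 'I_N -> {mpoly C[N]}) :
    (pairprod F).@[x] = pairprod (fun i j => (F i j).@[x]).
  rewrite /pairprod rmorph_prod; apply: eq_bigr => i _.
  by rewrite rmorph_prod.
have -> : (vdm C N).@[x] = (-1) ^+ rv *
    pairprod (fun i j : 'I_N => c * t ^+ i - c * t ^+ j).
  transitivity (pairprod (fun i j => x i - x j)).
    rewrite pairE; apply: eq_pairprod => i j _.
    by rewrite mevalB !mevalXU.
  transitivity ((-1) ^+ rv * pairprod (fun i j => x (rv i) - x (rv j))).
    by rewrite pairprod_perm mulrA -expr2 sqrr_sign mul1r.
  by congr (_ * _); apply: eq_pairprod => i j _; rewrite !rvE !xrev.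
have -> : (hl_num la t N).@[x] = (-1) ^+ rv * ((c ^+ psize la * t ^+ pn la) *
    pairprod (fun i j : 'I_N => c * t ^+ i - t * (c * t ^+ j))).
  rewrite /hl_num rmorph_sum (bigD1 rv) //= [X in _ + X]big1 ?addr0.
    rewrite !mevalM rmorph_sign pairE rmorph_prod /=.
    congr (_ * (_ * _)); last first.
      apply: eq_pairprod => i j _.
      by rewrite mevalB mevalM mevalC !mevalXU !rvE !xrev.
    rewrite (eq_bigr (fun i : 'I_N => c ^+ nth 0%N la i * t ^+ (i * nth 0%N la i))).
      rewrite big_split !prodrXr /=; congr (_ ^+ _ * _ ^+ _).
        rewrite /psize sumnE (big_nth 0%N) -(big_mkord xpredT (fun i => nth 0%N la i)).
        rewrite (@big_cat_nat _ _ _ (size la)) //= [X in (_ + X)%N]big_nat.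
        by rewrite [X in (_ + X)%N]big1 ?addn0 // => i /andP[li _]; rewrite nth_default.
      rewrite /pn -(big_mkord xpredT (fun i => i * nth 0%N la i)%N).
      rewrite -(big_mkord xpredT (fun i => i * nth 0%N la i)%N).
      rewrite (@big_cat_nat _ _ _ (size la)) //= [X in (_ + X)%N]big_nat.
      rewrite [X in (_ + X)%N]big1 ?addn0 // => i /andP[li _].
      by rewrite nth_default ?muln0.
    by move=> i _; rewrite rmorphXn /= mevalXU rvE xrev exprMn -exprM.
  move=> w wrv; have [/existsP[i /existsP[j /andP[ij /eqP wij]]]|noij] :=
      boolP [exists i : 'I_N, exists j : 'I_N, (i < j)%N && (w j == (w i).+1 :> nat)].
    rewrite !mevalM pairE; apply/eqP; rewrite !mulf_eq0; apply/orP; right.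
    apply/orP; right; apply/prodf_eq0; exists i => //; apply/prodf_eq0; exists j => //.
    rewrite mevalB mevalM mevalC !mevalXU /x mulrCA -exprS wij subr_eq0.
    by apply/eqP; congr (_ * _ ^+ _); have := ltn_ord (w j); rewrite wij; lia.
  case/eqP: wrv; apply/permP => i; rewrite rvE; apply: perm_rev => {}i j ij wij.
  case/negP: noij; apply/existsP; exists i; apply/existsP; exists j.
  by rewrite ij wij eqxx.
rewrite pairprod_geom mulrCA => /(mulfI (negbT (signr_eq0 _ _))).
move=> E; suff PP0 : pairprod (fun i j : 'I_N => c * t ^+ i - c * t ^+ j) != 0.
  by apply: (mulIf PP0); rewrite E mulrA; congr (_ * _); rewrite mulrC.
apply/prodf_neq0 => i _; apply/prodf_neq0 => j ij.
rewrite -mulrBr mulf_neq0 // subr_eq0; apply/negP => /eqP/expt_inj ji.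
by rewrite ji ltnn in ij.
Qed.

(** On the line through 0 and a geometric progression, the polynomial agrees with
    a multiple of c^|la| outside of 0, hence at 0. *)
Lemma hall_littlewood_at0 la N : (size la <= N)%N -> (0 < psize la)%N ->
  (hall_littlewood la t N).@[fun=> 0] = 0.
Proof.
move=> lN n0.
have [r rE] := meval_line (hall_littlewood la t N) (fun=> 0)
  (fun i => t ^+ (N - i.+1)).
have v0 := hl_vla_neq0 la N.
pose k := hl_v N t * t ^+ pn la / hl_vla la N t.
have rk : r - k *: 'X^(psize la) = 0.
  apply: (@poly_eq0_inf _ _ (fun j => j.+1%:R)).
    by move=> i j /eqP; rewrite eqr_nat => /eqP [].
  move=> j; rewrite hornerD hornerN hornerZ hornerXn rE.
  apply: (mulfI v0); rewrite mulr0 mulrBr; apply/eqP; rewrite subr_eq0; apply/eqP.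
  transitivity (hl_vla la N t *
      (hall_littlewood la t N).@[fun i => j.+1%:R * t ^+ (N - i.+1)]).
    by congr (_ * _); apply: meval_eq => i; rewrite add0r.
  rewrite hall_littlewood_geom ?pnatr_eq0 // /k.
  by rewrite [RHS]mulrA [hl_vla la N t * _]mulrC divfK // mulrA mulrAC.
transitivity r.[0].
  by rewrite rE; apply: meval_eq => i; rewrite mul0r addr0.
move/eqP: rk; rewrite subr_eq0 => /eqP ->.
by rewrite hornerZ hornerXn expr0n eqn0Ngt n0 mulr0.
Qed.

Definition hl_coef la : C :=
  t ^+ pn la / ((1 - t) ^+ size la * \prod_(i <- undup la) hl_v (count_mem i la) t).

Definition hl_poly la : {poly C} :=
  hl_coef la *: elemp [seq t ^- i | i <- iota 0 (size la)].

(** The quotient of v_N(t) by v_(N-l)(t) is a product of l factors 1 - t^(N-i),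
    each of them linear in t^N. *)
Lemma hl_polyE la N : (size la <= N)%N ->
  (hall_littlewood la t N).@[fun i => t ^+ (N - i.+1)] = (hl_poly la).[t ^+ N].
Proof.
move=> lN; have u0 : 1 - t != 0 by rewrite -(expr1 t) sub1t_neq0.
have v0 := hl_vla_neq0 la N.
have := hall_littlewood_geom (oner_neq0 C) lN; rewrite expr1n mul1r => E.
apply: (mulfI v0).
transitivity (hl_v N t * t ^+ pn la).
  by rewrite -E; congr (_ * _); apply: meval_eq => i; rewrite mul1r.
rewrite /hl_vla /hl_poly hornerZ /hl_coef /elemp big_map horner_prod.
set P := \prod_(i <- undup la) _.
have P0 : P != 0 by rewrite prodf_seq_neq0; apply/allP => i _; rewrite hl_v_neq0.
set l := size la in lN *.
have vE : hl_v N t * (1 - t) ^+ l =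
    hl_v (N - l) t * \prod_(i <- iota 0 l) (1 - t ^- i *: 'X).[t ^+ N].
  elim: (l) (lN) => [|k IH] kN; first by rewrite subn0 big_nil mulr1.
  rewrite exprSr mulrA IH 1?ltnW // -{2}(addn1 k) iotaD big_cat big_seq1 /= add0n.
  have kE : (N - k = (N - k.+1).+1)%N by lia.
  have tE : (1 - t ^- k *: 'X).[t ^+ N] = 1 - t ^+ (N - k).
    by rewrite !hornerE -{1}(subnK (ltnW kN)) exprD mulrC mulfK // expf_neq0.
  move: (\prod_(i <- _) _) => Q.
  by rewrite tE kE hl_vS; field.
move: (\prod_(i <- _) _) vE => Q vE.
have ul0 : (1 - t) ^+ l != 0 by rewrite expf_neq0.
apply: (mulIf ul0); rewrite mulrAC vE.
move: ((1 - t) ^+ l) ul0 => u ul0; field.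
by rewrite ul0 P0.
Qed.

Lemma hl_coef_neq0 la : hl_coef la != 0.
Proof.
rewrite mulf_neq0 ?expf_neq0 // invr_neq0 // mulf_neq0 ?expf_neq0 //.
  by rewrite -(expr1 t) sub1t_neq0.
by rewrite prodf_seq_neq0; apply/allP => i _; rewrite hl_v_neq0.
Qed.

Lemma hl_poly_small la k : (size la < k)%N -> (hl_poly la)`_k = 0.
Proof.
move=> lk; rewrite coefZ nth_default ?mulr0 // (leq_trans (size_elemp _)) //.
by rewrite size_map size_iota.
Qed.

Lemma hl_poly_lead la : (hl_poly la)`_(size la) != 0.
Proof.
rewrite coefZ mulf_neq0 ?hl_coef_neq0 //.
set s := [seq _ | _ <- _].
have szs : size s = size la by rewrite size_map size_iota.
rewrite -szs -coef_elemp_rev // subnn -horner_coef0 horner_prod prodf_seq_neq0.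
apply/allP => z /mapP[i _ ->].
by rewrite !hornerE oppr_eq0 invr_neq0 // expf_neq0.
Qed.

End Principal.

(** * Characters of the groups T_m and their direct limit *)

Section Orbits.

Variables (T : choiceType) (F : T -> T).

Lemma iter_period d x : iter d F x = x -> forall k, iter (k * d) F x = x.
Proof. by move=> dx; elim=> // k IH; rewrite mulSn iterD IH. Qed.

Lemma iter_modn d x i : iter d F x = x -> iter i F x = iter (i %% d) F x.
Proof. by move=> dx; rewrite {1}(divn_eq i d) addnC iterD iter_period. Qed.

Lemma iorbit_periodic m x : (0 < m)%N -> iter m F x = x ->
  exists d, [/\ (0 < d)%N, iter d F x = x, set_inj `I_d (fun i => iter i F x) &
    iorbit F x = (fun i => iter i F x) @` `I_d].
Proof.
move=> m0 mx.
have exP : exists d, (0 < d)%N && (iter d F x == x) by exists m; rewrite m0 mx eqxx.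
case: (ex_minnP exP) => d /andP[d0 /eqP dx] dmin; exists d; split => //.
  move=> i j; rewrite !inE /= => id jd; wlog ij : i j id jd / (i <= j)%N.
    move=> H E; case: (leqP i j) => ij; first exact: H.
    by apply/esym/H => //; exact: ltnW.
  move=> E; apply/eqP; rewrite eqn_leq ij /= leqNgt; apply/negP => ltij.
  have : (d <= j - i)%N; last by rewrite leqNgt; apply/negP/negPn; lia.
  apply: dmin; rewrite subn_gt0 ltij /=; apply/eqP.
  have H : iter (d - i) F (iter i F x) = x by rewrite -iterD subnK // ltnW.
  by rewrite -{1}H -iterD addnC iterD -(iterD (j - i) i) subnK // -E H.
apply/seteqP; split => [_ [i _ <-]|_ [i _ <-]]; last by exists i.
by exists (i %% d)%N; rewrite /= ?ltn_pmod // -iter_modn.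
Qed.

Lemma iorbit_eq m x y : (0 < m)%N -> iter m F x = x -> iorbit F x y ->
  iorbit F y = iorbit F x /\ iter m F y = y.
Proof.
move=> m0 mx [i _ <-]; split; last by rewrite -iterD addnC iterD mx.
apply/seteqP; split => [_ [j _ <-]|_ [j _ <-]].
  by exists (j + i)%N; rewrite // iterD.
exists (j + (m.-1 * i))%N => //; rewrite -iterD -addnA iterD; congr (iter j F _).
by rewrite addnC -mulSn prednK // mulnC iter_period.
Qed.

Lemma ocard_image d (f : nat -> T) : set_inj `I_d f -> ocard (f @` `I_d) = d.
Proof.
move=> finj; rewrite /ocard.
have -> : f @` `I_d = [set` [fset x in [seq f i | i <- iota 0 d]]%fset].
  apply/seteqP; split => [_ [i id <-]|x /=].
    by rewrite /= inE /=; apply/mapP; exists i; rewrite // mem_iota.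
  by rewrite inE /= => /mapP[k]; rewrite mem_iota => /andP[_ kd] ->; exists k.
rewrite set_fsetK card_fseq undup_id ?size_map ?size_iota //.
rewrite map_inj_in_uniq ?iota_uniq // => i j; rewrite !mem_iota !add0n => id jd.
by apply: finj; rewrite inE.
Qed.

End Orbits.

Section Characters.

Variables (K : closedFieldType) (q : nat).
Hypothesis q1 : (1 < q)%N.

Lemma exprz_root (e : int) (b : K) : e != 0 -> b != 0 ->
  exists2 a, a != 0 & a ^ e = b.
Proof.
have root n (c : K) : (0 < n)%N -> c != 0 -> exists2 a, a != 0 & a ^+ n = c.
  move=> n0 c0; have [a aE] := solve_monicpoly (fun i => if i == 0%N then c else 0) n0.
  have E : a ^+ n = c.
    rewrite aE; case: n n0 {aE} => // n _; rewrite big_ord_recl big1 ?addr0 ?mulr1 //.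
    by move=> i _; rewrite mul0r.
  exists a => //; apply: contraNneq c0 => a0; rewrite -E a0 expr0n.
  by case: n n0 {aE E}.
case: e => [n|n] e0 b0; first by apply: root => //; rewrite lt0n.
have [//||a a0 aE] := root n.+1 b^-1; first by rewrite invr_neq0.
by exists a => //; rewrite NegzE -exprnN aE invrK.
Qed.

Lemma negq_exp_neq1 m : (0 < m)%N -> ((- q%:Z) ^+ m - 1 != 0).
Proof.
move=> m0; rewrite subr_eq0; apply/eqP => /(congr1 absz).
rewrite abszX abszN /= => E; have : (1 < q ^ m)%N by rewrite -(exp1n m) ltn_exp2r.
by rewrite E.
Qed.

Lemma normT_exprz m r (a : K) : a != 0 ->
  normT q m r a = a ^ (\sum_(i < m %/ r) ((- q%:Z) ^+ r) ^+ i).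
Proof.
move=> a0; rewrite /normT; elim: (m %/ r)%N => [|k IH]; first by rewrite !big_ord0.
by rewrite !big_ord_recr /= IH exprM expfzDr.
Qed.

Lemma normT_expo m r : (r %| m)%N ->
  ((- q%:Z) ^+ r - 1) * \sum_(i < m %/ r) ((- q%:Z) ^+ r) ^+ i = (- q%:Z) ^+ m - 1.
Proof. by move=> rm; rewrite -subrX1 -exprM mulnC divnK. Qed.

Lemma TmE m (a : K) : a != 0 -> Tm q m a <-> a ^ ((- q%:Z) ^+ m - 1) = 1.
Proof.
move=> a0; rewrite expfzDr // exprN1; split=> [[_ ->]|E]; first by rewrite divff.
by split=> //; move/(congr1 (fun x => x * a)): E; rewrite mulfVK // mul1r.
Qed.

(** An element a of K^* with norm b satisfies
    a^((-q)^m - 1) = b^((-q)^r - 1) = 1: it lies in T_m. *)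
Lemma normT_surj m r (b : K) : (0 < m)%N -> (r %| m)%N -> Tm q r b ->
  exists2 a, Tm q m a & normT q m r a = b.
Proof.
move=> m0 rm bT; have b0 := bT.1.
have := negq_exp_neq1 m0; rewrite -(normT_expo rm) mulf_eq0 => /norP[_ e0].
have [a a0 aE] := exprz_root e0 b0; exists a; last by rewrite normT_exprz.
apply/(TmE _ a0); rewrite -(normT_expo rm) mulrC -exprz_exp aE.
exact/(TmE _ b0).
Qed.

(** Hilbert's theorem 90 for the action of F^r on T_m: a root c of order
    (-q)^r - 1 of a lies in T_m, by the same computation. *)
Lemma normT_ker m r (a : K) : (0 < r)%N -> (r %| m)%N -> Tm q m a ->
  normT q m r a = 1 -> exists2 c, Tm q m c & c ^ ((- q%:Z) ^+ r) = a * c.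
Proof.
move=> r0 rm aT; have a0 := aT.1; rewrite normT_exprz // => aN.
have [c c0 cE] := exprz_root (negq_exp_neq1 r0) a0; exists c.
  by apply/(TmE _ c0); rewrite -(normT_expo rm) -exprz_exp cE.
by rewrite -cE expfzDr // exprN1 mulfVK.
Qed.

Lemma exprz_fix (a : K) (w : int) : a ^ w = a -> forall i, a ^ (w ^+ i) = a.
Proof.
by move=> aw; elim=> [|i IH]; rewrite ?expr0 ?expr1z // exprS -exprz_exp aw.
Qed.

Lemma Tm_dvd m r (b : K) : (r %| m)%N -> Tm q r b -> Tm q m b.
Proof.
by move=> /dvdnP[k ->] [b0 bT]; split=> //; rewrite mulnC exprM exprz_fix.
Qed.

Lemma normT_fix m r (b : K) : Tm q r b -> normT q m r b = b ^+ (m %/ r).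
Proof.
move=> [b0 bT]; rewrite /normT -[X in b ^+ X]card_ord -prodr_const.
by apply: eq_bigr => i _; rewrite exprM exprz_fix.
Qed.

Lemma Tm1 m : Tm q m (1 : K).
Proof. by split; rewrite ?oner_neq0 // exp1rz. Qed.

Lemma TmV m (a : K) : Tm q m a -> Tm q m a^-1.
Proof. by move=> [a0 aT]; split; rewrite ?invr_neq0 // exprz_inv -invr_expz aT. Qed.

Lemma iter_Frob i (a : K) : iter i (Frob q) a = a ^ ((- q%:Z) ^+ i).
Proof.
elim: i => [|i IH]; first by rewrite expr0 expr1z.
by rewrite iterS IH /Frob exprz_exp exprSr.
Qed.

Variable C : fieldType.
Implicit Types (x y : K -> C) (xi : L K C q).

(** The element xi of L_m is the character x of T_m. *)
Definition represents m x xi := exists y : lchar K C q,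
  [/\ lev y = m, piL y = xi & (y : K -> C) = x].

Lemma represents_char m x xi : represents m x xi -> (0 < m)%N /\ is_char q m x.
Proof. by move=> [y [<- _ <-]]; split; [exact: lev_gt0|exact: chrP]. Qed.

Lemma represents_eqP m r x y xi : represents m x xi -> is_char q r y -> (0 < r)%N ->
  (exists2 k, [/\ (0 < k)%N, (m %| k)%N & (r %| k)%N] &
    forall a, Tm q k a -> x (normT q k m a) = y (normT q k r a)) ->
  represents r y xi.
Proof.
move=> [x' [<- <- <-]] yc r0 [k [k0 mk rk] H]; exists (LChar r0 yc); split=> //.
by apply/esym/piLP; exists k; split.
Qed.

(** The norm being onto, x is determined by its composition with any norm. *)
Lemma represents_uniq m x y xi : represents m x xi -> represents m y xi ->
  forall a, Tm q m a -> x a = y a.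
Proof.
move=> [x' [<- <- <-]] [y' [mE /esym/piLP [k [k0 xk yk E]] <-]] a aT.
have [b bT <-] := normT_surj k0 xk aT.
by rewrite E // mE.
Qed.

Lemma represents_inj m x xi xi' :
  represents m x xi -> represents m x xi' -> xi = xi'.
Proof.
move=> [y [<- <- yx]] [z [zy <- zx]]; apply/piLP; exists (lev y); split => //.
- exact: lev_gt0.
- by rewrite zy.
by move=> a aT; rewrite yx zx zy.
Qed.

Lemma represents_ext m x y xi : represents m x xi ->
  (forall a, Tm q m a -> x a = y a) -> represents m y xi.
Proof.
move=> xr xy; have [m0 [x0 xM]] := represents_char xr.
apply: (represents_eqP xr _ m0); last first.
  by exists m => // a aT; rewrite normT_id // xy.
split=> [a aT|a b aT bT]; rewrite -!xy; auto; last exact: TmM.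
Qed.

Lemma represents_lift m r x xi : (0 < m)%N -> (r %| m)%N -> represents r x xi ->
  represents m (fun a => x (normT q m r a)) xi.
Proof.
move=> m0 rm xr; have [r0 [x0 xM]] := represents_char xr.
apply: (represents_eqP xr _ m0); last first.
  by exists m => // a aT; rewrite (normT_id _ _ m0).
split=> [a aT|a b aT bT]; first by apply: x0; exact: normT_Tm aT.
by rewrite normTM xM //; [exact: normT_Tm aT|exact: normT_Tm bT].
Qed.

Lemma is_charM m x y : is_char q m x -> is_char q m y ->
  is_char q m (fun a => x a * y a).
Proof.
move=> [x0 xM] [y0 yM]; split=> [a aT|a b aT bT]; first by rewrite mulf_neq0 ?x0 ?y0.
by rewrite xM // yM // mulrACA.
Qed.

Lemma is_char_1 m x : is_char q m x -> x 1 = 1.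
Proof.
move=> [x0 xM]; have x10 := x0 1 (Tm1 m).
by apply: (mulfI x10); rewrite -xM ?mulr1 //; exact: Tm1.
Qed.

Lemma is_charX m x a k : is_char q m x -> Tm q m a -> x (a ^+ k) = x a ^+ k.
Proof.
move=> xc aT; have aX l : Tm q m (a ^+ l).
  by elim: l => [|l IH]; [exact: Tm1 | rewrite exprS; exact: TmM].
elim: k => [|k IH]; first by rewrite !expr0 (is_char_1 xc).
by case: xc => _ xM; rewrite !exprS xM // IH.
Qed.

Lemma represents_mul m x y xi eta : represents m x xi -> represents m y eta ->
  represents m (fun a => x a * y a) (mulL xi eta).
Proof.
move=> xr yr; have [m0 xc] := represents_char xr; have [_ yc] := represents_char yr.
case: xr yr => [x' [xm <- xE]] [y' [ym <- yE]]; rewrite mulL_pi.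
have r : represents (m * m) (mul_lchar x' y') (piL (mul_lchar x' y')).
  by exists (mul_lchar x' y'); rewrite /= xm ym.
apply: (represents_eqP r (is_charM xc yc) m0); exists (m * m)%N.
  by rewrite muln_gt0 m0 dvdnn dvdn_mulr.
by move=> a aT; rewrite normT_id ?muln_gt0 ?m0 //= xE yE xm ym.
Qed.

Lemma represents_one m : (0 < m)%N -> represents m (fun=> 1) (oneL K C q).
Proof.
move=> m0; have r : represents 1 (fun=> 1) (oneL K C q) by exists (one_lchar K C q).
exact: represents_lift m0 (dvd1n m) r.
Qed.

Lemma represents_exp m x xi k : represents m x xi ->
  represents m (fun a => x a ^+ k) (expL xi k).
Proof.
move=> xr; have [m0 _] := represents_char xr; elim: k => [|k IH].
  exact: represents_one.
apply: (represents_ext (represents_mul xr IH)) => a _; by rewrite exprS.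
Qed.

Lemma represents_prod m (I : eqType) (s : seq I) (x : I -> K -> C) (xi : I -> L K C q) :
  (0 < m)%N -> (forall i, i \in s -> represents m (x i) (xi i)) ->
  represents m (fun a => \prod_(i <- s) x i a)
    (\big[@mulL K C q/oneL K C q]_(i <- s) xi i).
Proof.
move=> m0; elim: s => [_|i s IH xr].
  rewrite big_nil; apply: (represents_ext (represents_one m0)) => a _.
  by rewrite big_nil.
have r := represents_mul (xr i (mem_head _ _))
  (IH (fun j js => xr j (mem_behead (s := i :: s) js))).
rewrite big_cons; apply: (represents_ext r) => a _.
by rewrite big_cons.
Qed.

Lemma represents_frob m x xi : represents m x xi ->
  represents m (fun a => x (Frob q a)) (frobL xi).
Proof. by move=> [y [<- <- <-]]; rewrite frobL_pi; exists (frob_lchar y). Qed.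

Lemma represents_iter m x xi i : represents m x xi ->
  represents m (fun a => x (iter i (Frob q) a)) (iter i (@frobL K C q) xi).
Proof.
move=> xr; elim: i => // i IH; apply: (represents_ext (represents_frob IH)) => a _.
by rewrite -iterSr.
Qed.

Lemma frobL_periodic m x xi : represents m x xi -> iter m (@frobL K C q) xi = xi.
Proof.
move=> xr; apply: (@represents_inj m x _ _ _ xr).
apply: (represents_ext (represents_iter m xr)) => a [a0 aT].
by rewrite iter_Frob aT.
Qed.

Lemma exists_represents xi : exists m x, represents m x xi.
Proof. by exists (lev (repr xi)), (repr xi), (repr xi); rewrite reprL. Qed.

Lemma represents_valL m x xi a : represents m x xi -> Tm q m a -> valL xi m a = x a.
Proof.
move=> xr aT; apply: xget_unique.
  by case: xr => y [ym yxi yx]; exists y; rewrite yx.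
move=> _ [y [ym yxi ->]].
by apply: (represents_uniq _ xr aT); exists y.
Qed.

(** A character of T_m fixed by F^d is trivial on the elements F^d(c) / c, which
    make up the kernel of the norm to T_d. *)
Lemma represents_descent d xi : (0 < d)%N -> iter d (@frobL K C q) xi = xi ->
  exists x, represents d x xi.
Proof.
move=> d0 dxi; have [m' [x' x'r]] := exists_represents xi.
have [m'0 _] := represents_char x'r; pose m := (d * m')%N.
have m0 : (0 < m)%N by rewrite muln_gt0 d0.
have dm : (d %| m)%N by rewrite dvdn_mulr.
have := represents_lift m0 (dvdn_mull d (dvdnn m')) x'r.
move: (fun a => _) => x xr {x' x'r}.
have [_ [x0 xM]] := represents_char xr.
have xF a : Tm q m a -> x (a ^ ((- q%:Z) ^+ d)) = x a.
  move=> aT; have := represents_iter d xr; rewrite dxi => xFr.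
  by have := represents_uniq xr xFr aT => /= ->; rewrite iter_Frob.
have xker a : Tm q m a -> normT q m d a = 1 -> x a = 1.
  move=> aT aN; have [c cT cE] := normT_ker d0 dm aT aN.
  by apply: (mulIf (x0 c cT)); rewrite mul1r -xM // -cE xF.
have xN a b : Tm q m a -> Tm q m b -> normT q m d a = normT q m d b -> x a = x b.
  move=> aT bT ab; have abT : Tm q m (a / b) by apply: TmM => //; exact: TmV.
  have E : a = a / b * b by rewrite divfK //; case: bT.
  rewrite E xM // xker ?mul1r //.
  have Nb0 : normT q m d b != 0 by case: (normT_Tm dm bT).
  by apply: (mulIf Nb0); rewrite mul1r -normTM -E.
pose y b := x (xget 1 [set a | Tm q m a /\ normT q m d a = b]).
have yN a : Tm q m a -> y (normT q m d a) = x a.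
  move=> aT; rewrite /y.
  have [bT bE] := @xgetI _ 1 [set b | Tm q m b /\ normT q m d b = normT q m d a] a
    (conj aT erefl).
  exact: xN.
exists y; apply: (represents_eqP xr _ d0).
  split=> [b bT|b c bT cT].
    by have [a aT <-] := normT_surj m0 dm bT; rewrite yN //; exact: x0.
  have [a aT <-] := normT_surj m0 dm bT; have [a' a'T <-] := normT_surj m0 dm cT.
  by rewrite -normTM !yN ?xM //; exact: TmM.
by exists m => // a aT; rewrite normT_id // yN.
Qed.

(** The restriction to T_1 of the character of T_d attached to an orbit of size
    d: composed with the norm it gives the product over the orbit. *)
Lemma Theta_represents (phi : set (L K C q)) : @Theta K C q phi ->
  exists x, [/\ (0 < ocard phi)%N, represents (ocard phi) x (xget (oneL K C q) phi) &
    forall k, represents 1 (fun a => x a ^+ k)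
      (\big[@mulL K C q/oneL K C q]_(xi \in phi) expL xi k)].
Proof.
move=> [xi0 _ <-] {phi}.
have [m [x0 /[dup] /represents_char[m0 _]]] := exists_represents xi0.
move=> /frobL_periodic mxi0; set phi := iorbit _ _.
have xiphi : phi (xget (oneL K C q) phi).
  by apply: (@xgetI _ _ _ xi0); exists 0%N.
set xi := xget _ _ in xiphi *.
have [phiE mxi] := iorbit_eq m0 mxi0 xiphi; rewrite -/phi in phiE.
have [d [d0 dxi dinj orbE]] := iorbit_periodic m0 mxi.
have cd : ocard phi = d by rewrite -phiE orbE ocard_image.
have [x xr] := represents_descent d0 dxi; exists x; rewrite cd; split=> // k.
have [_ xc] := represents_char xr.
have T1d (a : K) : Tm q 1 a -> Tm q d a by exact: Tm_dvd (dvd1n d).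
have x1c : is_char q 1 (fun a => x a ^+ k).
  case: xc => xn0 xM; split=> [a /T1d aT|a b /T1d aT /T1d bT].
    by rewrite expf_neq0 // xn0.
  by rewrite xM // exprMn.
rewrite -phiE orbE fsbig_image // -fsbig_ord.
have r := represents_prod (s := index_enum 'I_d) d0
  (fun (i : 'I_d) _ => represents_exp k (represents_iter i xr)).
apply: (represents_eqP r x1c) => //; exists d; first by rewrite d0 dvdnn dvd1n.
move=> a aT; rewrite normT_id //= prodrXl; congr (_ ^+ _).
have xprod (s : seq 'I_d) : x (\prod_(i <- s) iter i (Frob q) a) =
    \prod_(i <- s) x (iter i (Frob q) a).
  have iT i : Tm q d (iter i (Frob q) a) by elim: i => // i; exact: Frob_Tm.
  elim: s => [|i s IH]; first by rewrite !big_nil (is_char_1 xc).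
  case: xc => _ xM.
  rewrite !big_cons xM ?IH //; elim: (s) => [|j u IHu].
    by rewrite big_nil; exact: Tm1.
  by rewrite big_cons; exact: TmM.
rewrite -xprod; congr x; rewrite /normT divn1; apply: eq_bigr => i _.
by rewrite iter_Frob mul1n.
Qed.

End Characters.

(** * The class of a scalar matrix *)

Section ScalarClass.

Lemma is_partition_col n : is_partition (nseq n 1%N).
Proof.
rewrite /is_partition; apply/andP; split.
  by case: n => // n; elim: n.
by apply/negP => /nseqP[].
Qed.

Definition colp n : partn := Partn (is_partition_col n).

Lemma psize_colp n : psize (colp n) = n.
Proof. by rewrite /psize sumn_nseq mul1n. Qed.

Lemma partn_full (nu : partn) : size nu = psize nu -> nu = colp (psize nu).
Proof.
move=> sz; apply: val_inj => /=; rewrite -sz.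
have := partn_all_gt0 nu; move: sz; rewrite /psize.
elim: (nu : seq nat) => //= a s IH E /andP[a0 s0].
have szs : (size s <= sumn s)%N.
  by elim: s s0 {IH E} => //= b s IHs /andP[b0 /IHs]; lia.
have -> : a = 1%N by lia.
by rewrite {1}IH //; lia.
Qed.

Lemma psize_eq0 (nu : partn) : psize nu = 0%N -> nu = part0.
Proof.
move=> nu0; apply: val_inj; apply: size0nil; apply/eqP.
by rewrite -leqn0 -nu0 size_partn.
Qed.

Variable T : choiceType.

Definition single (X : set T) (nu : partn) : mpartn T := [fsfun [fsfun] with X |-> nu].

Lemma singleE X nu Y : single X nu Y = if Y == X then nu else part0.
Proof. by rewrite fsfun_withE fsfun0E. Qed.

Lemma finsupp_single X nu : nu != part0 -> finsupp (single X nu) = [fset X]%fset.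
Proof. by move=> nu0; rewrite finsupp_with (negPf nu0) finsupp0 fsetU0. Qed.

Lemma single_inj X : injective (single X).
Proof. by move=> nu nu' /(congr1 (fun f : mpartn T => f X)); rewrite !singleE eqxx. Qed.

Lemma eq_single X (la : mpartn T) :
  (forall Y, Y \in finsupp la -> Y = X) -> la = single X (la X).
Proof.
move=> H; apply/fsfunP => Y; rewrite singleE; case: eqP => [-> //|YX].
by apply: fsfun_dflt; apply/negP => /H.
Qed.

End ScalarClass.

Section ScalarUnitary.

Variables (K : closedFieldType) (q : nat) (al : K).
Hypotheses (q0 : (0 < q)%N) (alT : Tm q 1 al).

Lemma iorbit_center (a : K) : (iorbit (Frob q) a = [set al]) <-> a = al.
Proof.
split=> [E|->].
  by have : [set al] a by rewrite -E; exists 0%N.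
have alF i : iter i (Frob q) al = al.
  by rewrite iter_Frob exprz_fix //; case: alT => _; rewrite expr1.
by apply/seteqP; split => [_ [i _ <-]|_ ->]; [rewrite /= alF | exists 0%N].
Qed.

Lemma ocard_center : ocard [set al] = 1%N.
Proof. by rewrite /ocard fset_set1 cardfs1. Qed.

Lemma sum_single (w : partn -> nat) nu : w part0 = 0%N ->
  (\sum_(X <- finsupp (single [set al] nu))
    ocard X * w (single [set al] nu X))%N = w nu.
Proof.
move=> w0; have [->|nu0] := eqVneq nu part0.
  by rewrite w0 big1 // => X _; rewrite singleE if_same w0 muln0.
by rewrite finsupp_single // big_seq_fset1 singleE eqxx ocard_center mul1n.
Qed.

Lemma mpn_single nu : mpn (single [set al] nu) = pn nu.
Proof. by apply: (sum_single (w := pn)); rewrite /pn big_ord0. Qed.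

Lemma single_mparts n nu : psize nu = n -> mparts (@Phi K q) n (single [set al] nu).
Proof.
move=> nun; split; last by rewrite (sum_single (w := psize)).
move=> X; have [->|nu0] := eqVneq nu part0.
  by rewrite mem_finsupp singleE if_same eqxx.
rewrite finsupp_single // inE => /eqP ->; exists al; first by case: alT.
exact/iorbit_center.
Qed.

Lemma scalar_uclass n : uclass q (single [set al] (colp n)) (al%:M : 'M[K]_n).
Proof.
have [al0 alE] := alT; split.
  have u : (al%:M : 'M[K]_n) \in unitmx by rewrite unitmxE det_scalar unitrX // unitfE.
  split=> //; have -> : map_mx (fun x => x ^+ q) (al%:M : 'M[K]_n) = (al ^+ q)%:M.
    apply/matrixP => i j; rewrite !mxE; case: (i == j) => //.
    by rewrite !mulr0n expr0n; case: (q) q0.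
  rewrite tr_scalar_mx invmx_scalar; congr (_%:M).
  by move: alE; rewrite expr1 -exprnN.
exists (nseq n (al, 1%N)).
  split; first by apply/allP => b /nseqP[-> _].
  set s := nseq n _.
  have sN (i : 'I_(size s)) : nth (0, 0%N) s i = (al, 1%N).
    have [_ ->] : (i < size s)%N /\ nth (0, 0%N) s i = (al, 1%N); last by [].
    by case: i => i /=; rewrite /s size_nseq nth_nseq => ->.
  set p := fun i : 'I_(size s) => (nth (0, 0%N) s i).2.
  have dE : (\sum_i p i)%N = n.
    rewrite (eq_bigr (fun=> 1%N)) => [|i _]; last by rewrite /p sN.
    by rewrite sum1_card card_ord size_nseq.
  have JE : \mxdiag_(i < size s) jordan_block (nth (0, 0%N) s i).1 (p i) = al%:M.
    rewrite -mxdiagZ; apply: eq_mxdiag => i; apply/matrixP => j k; rewrite !mxE sN /=.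
    rewrite (_ : (j.+1 == k :> nat) = false) ?addr0 //.
    have p1 : p i = 1%N by rewrite /p sN.
    have : (k < 1)%N by rewrite -[X in (_ < X)%N]p1.
    by case: (k : nat).
  exists (pid_mx n); rewrite JE; split.
  - by rewrite -row_leq_rank rank_pid_mx ?dE.
  - by rewrite -col_leq_rank rank_pid_mx ?dE.
  by rewrite mul_mx_scalar mul_scalar_mx.
move=> a a0; rewrite singleE; case: eqP => [/iorbit_center ->|na].
  suff -> : [seq b.2 | b <- nseq n (al, 1%N) & b.1 == al] = nseq n 1%N by [].
  by elim: (n) => //= m IH; rewrite eqxx /= IH.
suff -> : [seq b.2 | b <- nseq n (al, 1%N) & b.1 == a] = [::] by [].
have al_a : (al == a) = false.
  by apply/negP => /eqP ala; apply: na; apply/iorbit_center.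
by elim: (n) => //= m IH; rewrite al_a.
Qed.

End ScalarUnitary.

(** * Evaluation of polynomials in a family of variables *)

Section Evaluation.

Variables (C : comNzRingType) (I : choiceType).

Definition cm_eval (x : I -> C) (m : monalg.cmonom I) : C :=
  \prod_(i <- finsupp m) x i ^+ m i.

Lemma cm_eval_wide (x : I -> C) (m : monalg.cmonom I) (A : {fset I}) :
  (finsupp m `<=` A)%fset -> cm_eval x m = \prod_(i <- A) x i ^+ m i.
Proof.
move=> mA; apply: (big_fset_incl _ mA) => i _ im.
by rewrite (fsfun_dflt im) expr0.
Qed.

Lemma cm_eval_mmorphism x : monalg.mmorphism (cm_eval x).
Proof.
split=> [m1 m2|]; last by rewrite /cm_eval monalg.mdom1 big_seq_fset0.
rewrite (@cm_eval_wide x m1 (finsupp m1 `|` finsupp m2)%fset) ?fsubsetUl //.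
rewrite (@cm_eval_wide x m2 (finsupp m1 `|` finsupp m2)%fset) ?fsubsetUr //.
rewrite /cm_eval monalg.mdomD -big_split; apply: eq_bigr => i _.
by rewrite /= monalg.cmM exprD.
Qed.

HB.instance Definition _ x :=
  monalg.isMultiplicative.Build (monalg.cmonom I) C (cm_eval x) (cm_eval_mmorphism x).

Definition malg_eval (x : I -> C) : monalg.malg (monalg.cmonom I) C -> C :=
  monalg.mmap idfun (cm_eval x).

HB.instance Definition _ x := GRing.RMorphism.copy (malg_eval x)
  (monalg.mmap idfun (cm_eval x)).

Lemma malg_evalZ x c g : malg_eval x (c *: g) = c * malg_eval x g.
Proof. exact: monalg.mmapZ. Qed.

Lemma malg_evalU x i : malg_eval x (monalg.mkmalgU (monalg.ucm i) 1) = x i.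
Proof.
rewrite /malg_eval monalg.mmapU mul1r /cm_eval monalg.mdomU big_seq_fset1.
by rewrite monalg.cmUU expr1.
Qed.

Lemma malg_eval_mmap x n (p : {mpoly C[n]}) g :
  malg_eval x (mmap (fun c : C => c%:A) g p) = p.@[fun i => malg_eval x (g i)].
Proof.
rewrite /mmap mevalE rmorph_sum; apply: eq_bigr => m _.
rewrite rmorphM /= malg_evalZ rmorph1 mulr1; congr (_ * _).
by rewrite /mmap1 rmorph_prod; apply: eq_bigr => i _; rewrite rmorphXn.
Qed.

End Evaluation.

(** * The defining identity at a central class *)

Section Center.

Variables (K : closedFieldType) (C : numClosedFieldType) (q : nat).
Hypothesis q1 : (1 < q)%N.
Implicit Types (al : K) (phi : set (L K C q)).

Let q0 : (0 < q)%N := ltnW q1.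

Lemma Tm_finite m : (0 < m)%N -> finite_set (Tm q m : set K).
Proof.
move=> m0; set e := (- q%:Z) ^+ m - 1; have e0 := negq_exp_neq1 q1 m0.
have p0 : 'X^`|e|%N - 1 != 0 :> {poly K}.
  by rewrite -size_poly_eq0 size_XnsubC // absz_gt0.
have [s pE] := closed_field_poly_normal ('X^`|e|%N - 1 : {poly K}).
apply: (sub_finite_set _ (finite_seq s)) => a aT /=; have a0 := aT.1.
have ae : a ^+ `|e|%N = 1.
  move/(TmE q m a0): aT; rewrite -/e; case: (e) => n /=; first by [].
  by rewrite NegzE -exprnN => /eqP; rewrite invr_eq1 => /eqP.
have : root ('X^`|e|%N - 1) a by rewrite /root !hornerE ae subrr.
by rewrite pE rootZ ?lead_coef_eq0 // root_prod_XsubC.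
Qed.

(** At such a point only the classes with the single eigenvalue al survive. *)
Definition at_center al N (v : 'I_N -> C) (p : set K * 'I_N) : C :=
  if p.1 == [set al] then v p.2 else 0.

Definition psumY_sign phi i : C := (-1) ^+ (i.+1 * ocard phi).-1.

(** The part of s_la at [at_center al v] that does not depend on al. *)
Definition schur_center (la : mpartn (L K C q)) N (v : 'I_N -> C) : C :=
  \prod_(phi <- finsupp la)
    (schur_psum C (la phi)).@[
      fun i => psumY_sign phi i * \sum_j v j ^+ (i.+1 * ocard phi)].

Lemma eval_psumX al N (v : 'I_N -> C) f k : (0 < k)%N ->
  malg_eval (at_center al v) (psumX C N f k) =
  if f == [set al] then \sum_j v j ^+ k else 0.
Proof.
move=> k0; rewrite /psumX rmorph_sum /=.
rewrite (eq_bigr (fun j => at_center al v (f, j) ^+ k)); last first.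
  by move=> j _; rewrite rmorphXn /= malg_evalU.
rewrite /at_center /=; case: eqP => // _.
by rewrite big1 // => j _; rewrite expr0n eqn0Ngt k0.
Qed.

(** Only the term of al survives, and N_(m,d)(al) = al^(m/d) because F fixes
    al. *)
Lemma eval_psumY al N (v : 'I_N -> C) phi (x : K -> C) i :
  Tm q 1 al -> (0 < ocard phi)%N -> represents (ocard phi) x (xget (oneL K C q) phi) ->
  malg_eval (at_center al v) (psumY N phi i.+1) =
  x al ^+ i.+1 * (psumY_sign phi i * \sum_j v j ^+ (i.+1 * ocard phi)).
Proof.
move=> alT d0 xr; set d := ocard phi in d0 xr *; set m := (i.+1 * d)%N.
have m0 : (0 < m)%N by rewrite muln_gt0 d0.
have alTd : Tm q d al by exact: Tm_dvd (dvd1n d) alT.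
have alTm : Tm q m al by exact: Tm_dvd (dvd1n m) alT.
rewrite /psumY -/d -/m malg_evalZ.
rewrite (fsbig_finite _ _ (Tm_finite m0)) rmorph_sum /=.
have xc := (represents_char xr).2.
have alin : al \in fset_set (Tm q m : set K).
  by rewrite in_fset_set ?inE //; exact: Tm_finite.
rewrite (big_fsetD1 al) //= [X in _ + X]big_seq [X in _ + X]big1 => [|a].
  rewrite addr0 malg_evalZ.
  have -> : iorbit (Frob q) al = [set al] by apply/(iorbit_center alT).
  rewrite ocard_center dvd1n divn1 eval_psumX // eqxx.
  have -> : valL (xget (oneL K C q) phi) m al = x al ^+ i.+1.
    have r := represents_lift m0 (dvdn_mull i.+1 (dvdnn d)) xr.
    by rewrite (represents_valL q1 r alTm) normT_fix // mulnK // (is_charX _ xc).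
  by rewrite mulrCA.
rewrite !inE => /andP[aal _]; rewrite malg_evalZ; case: ifP => dm; last first.
  by rewrite rmorph0 mulr0.
have k0 : (0 < m %/ ocard (iorbit (Frob q) a))%N.
  by rewrite divn_gt0; [exact: dvdn_leq | exact: dvdn_gt0 dm].
rewrite (eval_psumX _ _ _ k0).
by case: eqP => [/(iorbit_center alT)/eqP|]; rewrite ?(negPf aal) // mulr0.
Qed.

Lemma omegaL_represents (la : mpartn (L K C q)) :
  (forall phi, phi \in finsupp la -> Theta phi) ->
  exists x : set (L K C q) -> K -> C,
    (forall phi, phi \in finsupp la -> (0 < ocard phi)%N /\
      represents (ocard phi) (x phi) (xget (oneL K C q) phi)) /\
    represents 1 (fun a => \prod_(phi <- finsupp la) x phi a ^+ psize (la phi))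
      (omegaL la).
Proof.
move=> laT.
have /choice[x xP] : forall phi, exists y : K -> C, Theta phi ->
    [/\ (0 < ocard phi)%N, represents (ocard phi) y (xget (oneL K C q) phi) &
    forall k, represents 1 (fun a => y a ^+ k)
      (\big[@mulL K C q/oneL K C q]_(xi \in phi) expL xi k)].
  move=> phi; have [Tphi|nT] := pselect (Theta phi); last by exists (fun=> 0) => /nT.
  by have [y yP] := Theta_represents q1 Tphi; exists y.
exists x; split=> [phi /laT/xP[d0 xr _]|]; first by split.
by apply: represents_prod => // phi /laT/xP[_ _]; exact.
Qed.

Lemma valL_omegaL_neq0 al (la : mpartn (L K C q)) : Tm q 1 al ->
  (forall phi, phi \in finsupp la -> Theta phi) -> valL (omegaL la) 1 al != 0.
Proof.
move=> alT /omegaL_represents[x [_ xr]]; rewrite (represents_valL q1 xr alT).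
exact: (represents_char xr).2.1 alT.
Qed.

Lemma valL_omegaL_1 (la : mpartn (L K C q)) :
  (forall phi, phi \in finsupp la -> Theta phi) -> valL (omegaL la) 1 1 = 1.
Proof.
move=> /omegaL_represents[x [_ xr]]; rewrite (represents_valL q1 xr (Tm1 _ _ _)).
exact: is_char_1 (represents_char xr).2.
Qed.

Lemma eval_schurY al N (v : 'I_N -> C) (la : mpartn (L K C q)) :
  Tm q 1 al -> (forall phi, phi \in finsupp la -> Theta phi) ->
  malg_eval (at_center al v) (schurY N la) =
  valL (omegaL la) 1 al * schur_center la v.
Proof.
move=> alT /omegaL_represents[x [xP omr]].
rewrite (represents_valL q1 omr alT) /schurY /schur_center rmorph_prod -big_split.
rewrite big_seq [RHS]big_seq; apply: eq_bigr => phi phila.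
have [d0 xr] := xP phi phila.
have c0 : x phi al != 0.
  by apply: (represents_char xr).2.1; exact: Tm_dvd (dvd1n _) alT.
rewrite /= malg_eval_mmap -(schur_psum_scale (la phi)
  (fun i => psumY_sign phi i * \sum_j v j ^+ (i.+1 * ocard phi)) c0).
by apply: meval_eq => i; rewrite (eval_psumY _ _ alT d0 xr).
Qed.

(** The power sums p_1, ..., p_N of v are arbitrary, so that no factor vanishes
    identically as a polynomial in v. *)
Lemma schur_center_neq0 n N (la : mpartn (L K C q)) :
  mparts (@Theta K C q) n la -> (n <= N)%N -> exists v : 'I_N -> C,
  schur_center la v != 0.
Proof.
move=> [laT lan] nN.
pose R phi : {mpoly C[N]} := schur_psum C (la phi) \mPo
  [tuple psumY_sign phi i *: psum C N (i.+1 * ocard phi) | i < psize (la phi)].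
have RE phi (v : 'I_N -> C) : (R phi).@[v] = (schur_psum C (la phi)).@[
    fun i => psumY_sign phi i * \sum_j v j ^+ (i.+1 * ocard phi)].
  rewrite /R meval_comp; apply: meval_eq => i.
  by rewrite tnth_mktuple mevalZ meval_psum.
have [|v vE] := @meval_common_neq0 C N [seq R phi | phi <- finsupp la].
  move=> _ /mapP[phi phila ->].
  have [y yE] := schur_psum_neq0 C (la phi).
  have [x [d0 _ _]] := Theta_represents q1 (laT phi phila).
  set d := ocard phi in d0 *.
  have [v vY] := power_sums_onto N (fun j => (-1) ^+ j * y (j.+1 %/ d).-1).
  exists v; rewrite RE; apply: contraNneq yE => <-; apply/eqP/meval_eq => i.
  have jN : ((i.+1 * d).-1 < N)%N.
    rewrite prednK ?muln_gt0 ?d0 //; apply: leq_trans nN; rewrite -lan.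
    rewrite (big_fsetD1 phi) //= -/d mulnC; apply: leq_trans (leq_addr _ _).
    by rewrite leq_mul2l ltn_ord orbT.
  have := vY _ jN; rewrite prednK ?muln_gt0 ?d0 // => ->.
  by rewrite mulnK // /psumY_sign -/d mulrA -expr2 sqrr_sign mul1r.
exists v; move: vE; rewrite big_map rmorph_prod /= /schur_center.
by under eq_bigr do rewrite RE.
Qed.

(** The value of P_mu at [at_center al v] when mu is nu on {al} and empty
    elsewhere. *)
Definition hl_center (nu : partn) N (v : 'I_N -> C) : C :=
  (- q%:R) ^- pn nu * (hall_littlewood nu (- q%:R)^-1 N).@[v].

Lemma negqV_neq0 : (- q%:R : C)^-1 != 0.
Proof. by rewrite invr_neq0 // oppr_eq0 pnatr_eq0 -lt0n. Qed.

Lemma negqX_neq1 k : (0 < k)%N -> (- q%:R : C) ^+ k != 1.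
Proof.
move=> k0; have := negq_exp_neq1 q1 k0; rewrite subr_eq0; apply: contraNneq.
have -> : (- q%:R : C) = (- q%:Z)%:~R by rewrite rmorphN /= -pmulrn.
by rewrite -rmorphXn /= => /eqP; rewrite -[1 in X in X -> _]/(1%:~R) eqr_int.
Qed.

Lemma negqVX_neq1 d : (0 < d)%N -> forall k, (0 < k)%N -> ((- q%:R : C) ^- d) ^+ k != 1.
Proof.
move=> d0 k k0; rewrite exprVn -exprM invr_eq1 negqX_neq1 // muln_gt0 d0.
by [].
Qed.

Hypothesis Phi_finite : forall f, @Phi K q f -> finite_set f.

Lemma eval_hlX al n N (v : 'I_N -> C) (mu : mpartn K) :
  Tm q 1 al -> (0 < n <= N)%N -> mparts (@Phi K q) n mu ->
  malg_eval (at_center al v) (hlX C q N mu) =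
  if mu == single [set al] (mu [set al]) then hl_center (mu [set al]) v else 0.
Proof.
move=> alT /andP[n0 nN] [muP mun].
rewrite /hlX malg_evalZ rmorph_prod /=.
under eq_bigr do rewrite malg_eval_mmap.
case: eqP => [muE|nmu].
  set nu := mu [set al] in muE *.
  have nu0 : nu != part0.
    apply: contraTneq n0 => nu0; rewrite -mun muE nu0.
    by rewrite (sum_single al (w := psize)).
  rewrite muE finsupp_single // big_seq_fset1 mpn_single /hl_center.
  rewrite ocard_center expr1 !singleE eqxx; congr (_ * _); apply: meval_eq => i.
  by rewrite malg_evalU /at_center /= eqxx.
have [f fmu fal] : exists2 f, f \in finsupp mu & f != [set al].
  apply: contrapT => H; apply: nmu; apply: eq_single => Y Ymu.
  by apply/eqP/negPn/negP => Yal; apply: H; exists Y.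
have d0 : (0 < ocard f)%N.
  have [a _ fE] := muP f fmu; rewrite /ocard cardfs_gt0; apply/fset0Pn; exists a.
  rewrite in_fset_set; last exact: Phi_finite (muP f fmu).
  by rewrite inE -fE; exists 0%N.
have psf : (psize (mu f) <= N)%N.
  apply: leq_trans nN; rewrite -mun (big_fsetD1 f) //=.
  by apply: leq_trans (leq_addr _ _); rewrite leq_pmull.
have h0 : (hall_littlewood (mu f) ((- q%:R : C) ^- ocard f) N).@[fun=> 0] = 0.
  apply: hall_littlewood_at0.
  - by rewrite invr_neq0 // expf_neq0 // -invr_eq0 negqV_neq0.
  - exact: negqVX_neq1.
  - exact: leq_trans (size_partn _) psf.
  rewrite lt0n; apply: contraTneq fmu => /psize_eq0 mf0.
  by rewrite mem_finsupp mf0 eqxx.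
have h0' : (hall_littlewood (mu f) ((- q%:R : C) ^- ocard f) N).@[
    fun i => malg_eval (at_center al v) (Xvar C f i)] = 0.
  rewrite -[RHS]h0; apply: meval_eq => i.
  by rewrite malg_evalU /at_center /= (negPf fal).
rewrite (big_fsetD1 f fmu).
rewrite [X in _ * (X * _)](_ : _ = 0).
  by rewrite mul0r mulr0.
exact: h0'.
Qed.

(** The identity defining chi^la, at the points supported on a central class:
    its right-hand side only keeps the classes with the single eigenvalue al. *)
Lemma chi_values_center n N (la : mpartn (L K C q)) c al (v : 'I_N -> C) :
  chi_values n la c -> mparts (@Theta K C q) n la -> Tm q 1 al -> (0 < n <= N)%N ->
  (-1) ^+ (n./2 + mpn la) * (valL (omegaL la) 1 al * schur_center la v) =
  \sum_(nu \in [set nu | psize nu = n]) c (single [set al] nu) * hl_center nu v.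
Proof.
move=> cv laP alT nN; have [n0 nleN] := andP nN.
have evl := eval_schurY _ alT laP.1.
have := cv N; case: finite_supportP => [_ E|X XP X0 _ E].
  (* A sum with infinite support is 0, but the Schur side takes nonzero values. *)
  have [w wE] := schur_center_neq0 laP nleN.
  have /eqP := congr1 (malg_eval (at_center al w)) E.
  rewrite big_nil rmorph0 malg_evalZ eval_schurY //; last exact: laP.1.
  rewrite mulf_eq0 signr_eq0 mulf_eq0 (negPf wE) orbF.
  by rewrite (negPf (valL_omegaL_neq0 alT laP.1)).
have := congr1 (malg_eval (at_center al v)) E.
rewrite malg_evalZ evl rmorph_sum /= => ->.
set P := [set nu | psize nu = n].
have sP nu : P nu -> mparts (@Phi K q) n (single [set al] nu) by exact: single_mparts.
pose G mu : C := malg_eval (at_center al v) (c mu *: hlX C q N mu).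
transitivity (\sum_(mu \in [set` X]) G mu).
  by rewrite fsbig_finite ?set_fsetK //; exact: finite_fset.
transitivity (\sum_(mu \in [set` X] `|` single [set al] @` P) G mu).
  apply: fsbig_widen; first by left.
  move=> mu [[//|[nu nuP <-]] nX] /=; rewrite /G X0 ?rmorph0 //; last exact/negP.
  exact: sP.
rewrite -(fsbig_widen (single [set al] @` P)).
- rewrite fsbig_image; last by move=> a b _ _; exact: single_inj.
  apply: eq_fsbigr => nu /[!inE] nuP.
  by rewrite /G malg_evalZ (eval_hlX _ alT nN (sP _ nuP)) !singleE eqxx eqxx.
- by right.
move=> mu [[muX|[nu nuP <-]] nimg] /=; last by case: nimg; exists nu.
have muP := XP _ muX; rewrite /G malg_evalZ (eval_hlX _ alT nN muP).
case: eqP => [muE|_]; last exact: mulr0.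
case: nimg; exists (mu [set al]); last by rewrite -muE.
case: muP => _ mun; rewrite /P /= -[RHS]mun.
by rewrite [in RHS]muE (sum_single al (w := psize)).
Qed.

End Center.

(** * Separation of the scalar class *)

Lemma finite_partn n : finite_set [set nu : partn | psize nu = n].
Proof.
pose f (nu : partn) : {ffun 'I_n -> 'I_n.+1} := [ffun i : 'I_n => inord (nth 0%N nu i)].
have nle (nu : partn) i : psize nu = n -> (nth 0%N nu i < n.+1)%N.
  move=> nun; rewrite ltnS -nun.
  case: (ltnP i (size nu)) => il; last by rewrite nth_default.
  by have := nth_size_sumn (partn_all_gt0 nu) il; rewrite /psize; lia.
have finj : {in [set nu : partn | psize nu = n] &, injective f}.
  move=> nu nu' /[!inE] /= nun nu'n /ffunP E; apply: val_inj => /=.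
  have Enth i : nth 0%N nu i = nth 0%N nu' i.
    case: (ltnP i n) => ilt; last first.
      by rewrite !nth_default // (leq_trans (size_partn _)) ?nun ?nu'n.
    have := E (Ordinal ilt); rewrite !ffunE /= => /(congr1 val) /=.
    by rewrite !inordK ?nle.
  have ssz (l l' : partn) : (forall i, nth 0%N l i = nth 0%N l' i) ->
      (size l <= size l')%N.
    move=> ll'; rewrite leqNgt; apply/negP => lt.
    by have := partn_gt0 lt; rewrite ll' nth_default.
  by apply: (@eq_from_nth _ 0%N) => [|i _] //; apply/eqP; rewrite eqn_leq !ssz.
by rewrite -(eq_finite_set (inj_card_eq finj)); exact: finite_finset.
Qed.

Section Separation.

Variables (C : numClosedFieldType) (q : nat).
Hypothesis q1 : (1 < q)%N.

(** At (t^(N-1), ..., t, 1), with t = -1/q, the sum is a polynomial in t^N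
    whose coefficient of degree n only involves the partition with n parts. *)
Lemma hl_separate n (D : partn -> C) : (0 < n)%N ->
  (forall N (v : 'I_N -> C), (n <= N)%N ->
    \sum_(nu \in [set nu | psize nu = n]) D nu * hl_center q nu v = 0) ->
  D (colp n) = 0.
Proof.
move=> n0 H; set t : C := (- q%:R)^-1.
have t0 : t != 0 by exact: negqV_neq0.
have t_unit k : (0 < k)%N -> t ^+ k != 1.
  by move=> k0; rewrite /t exprVn invr_eq1 negqX_neq1.
set S := fset_set [set nu : partn | psize nu = n].
have SP nu : (nu \in S) = (psize nu == n).
  by rewrite in_fset_set ?inE; [apply/asboolP/eqP | exact: finite_partn].
pose P := \sum_(nu <- S) (D nu * (- q%:R) ^- pn nu) *: hl_poly t nu.
have P0 : P = 0.
  apply: (@poly_eq0_inf _ _ (fun k => t ^+ (n + k))) => [i j /(expt_inj t0 t_unit)|k].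
    by move/addnI.
  have := H (n + k)%N (fun i => t ^+ (n + k - i.+1)) (leq_addr _ _).
  rewrite (fsbig_finite _ _ (finite_partn n)) -/S => E; rewrite -[RHS]E /P horner_sum.
  rewrite big_seq [RHS]big_seq; apply: eq_bigr => nu; rewrite SP => /eqP nun.
  rewrite hornerZ /hl_center -mulrA -hl_polyE // (leq_trans (size_partn nu)) //.
  by rewrite nun leq_addr.
have colS : colp n \in S by rewrite SP psize_colp.
have := congr1 (fun p : {poly C} => p`_n) P0.
rewrite coef0 coef_sum (big_fsetD1 (colp n)) //= [X in _ + X]big_seq [X in _ + X]big1.
  rewrite addr0 coefZ => /eqP; have := hl_poly_lead t0 t_unit (colp n).
  rewrite size_nseq => l0; rewrite !mulf_eq0 (negPf l0) orbF => /orP[/eqP //|].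
  by rewrite invr_eq0 expf_eq0 oppr_eq0 pnatr_eq0 (gtn_eqF (ltnW q1)) andbF.
move=> nu; rewrite !inE SP => /andP[nuc /eqP nun].
rewrite coefZ hl_poly_small ?mulr0 // ltn_neqAle -{2}nun size_partn andbT.
by apply: contra nuc => /eqP sz; apply/eqP; rewrite -nun; apply: partn_full; rewrite sz.
Qed.

End Separation.

(** * Finiteness of the orbits *)

Section OrbitsFinite.

Variables (Fq : finFieldType) (K : closedFieldType) (iota : {rmorphism Fq -> K}).
Hypothesis algK : integralRange iota.

(** The powers of a only depend on the remainders of the X^i modulo an equation
    of a over the finite field, so two of them coincide. *)
Lemma root_of_unity (a : K) : a != 0 -> exists2 e, (0 < e)%N & a ^+ e = 1.
Proof.
move=> a0; have [p pm pa] := algK a.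
have p0 : p != 0 by exact: monic_neq0.
pose d := (size p).-1.
pose r i : {ffun 'I_d -> Fq} := [ffun k : 'I_d => ('X^i %% p)`_k].
have rE i j : r i = r j -> a ^+ i = a ^+ j.
  move=> rij; have aX l : a ^+ l = (map_poly iota ('X^l %% p)).[a].
    rewrite -[LHS](hornerXn a l) -(map_polyXn iota) {1}(divp_eq 'X^l p).
    by rewrite rmorphD rmorphM /= hornerD hornerM (rootP pa) mulr0 add0r.
  rewrite !aX; congr (_.[_]); congr map_poly; apply/polyP => k.
  case: (ltnP k d) => kd; first by have /ffunP/(_ (Ordinal kd)) := rij; rewrite !ffunE.
  have szm l : (size ('X^l %% p)%R <= d)%N.
    by rewrite -ltnS /d prednK ?ltn_modp // lt0n size_poly_eq0.
  by rewrite !nth_default // (leq_trans (szm _)).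
have : ~~ injectiveb (fun i : 'I_(#|{ffun 'I_d -> Fq}|.+1) => r i).
  apply/negP => /injectiveP rinj; have := leq_card _ rinj.
  by rewrite card_ord ltnn.
move=> /injectivePn[i [j ij /rE]].
wlog ltij : i j ij / (i < j)%N.
  move=> W E; case: (ltngtP i j) => lij; first exact: (W i j).
    by apply: (W j i); rewrite // eq_sym.
  by case/eqP: ij; exact: val_inj.
move=> E; exists (j - i)%N; first by rewrite subn_gt0.
apply: (mulIf (expf_neq0 i a0)); rewrite mul1r -exprD subnK //; exact: ltnW.
Qed.

Lemma Phi_finite f : @Phi K #|Fq| f -> finite_set f.
Proof.
move=> [a a0 <-]; have [e e0 ae] := root_of_unity a0.
apply: (sub_finite_set _ (finite_seq [seq a ^+ k | k <- seq.iota 0 e])).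
move=> _ [i _ <-]; rewrite iter_Frob /=; set z := (- _) ^+ i.
apply/mapP; exists `|(z %% e)%Z|%N.
  rewrite mem_iota /= add0n -ltz_nat gez0_abs ?modz_ge0 ?ltz_pmod //.
  by rewrite eqz_nat -lt0n.
rewrite {1}(divz_eq z e) expfzDr // mulrC exprnP gez0_abs ?modz_ge0 //; last first.
  by rewrite eqz_nat -lt0n.
by rewrite [(_ %/ _)%Z * _]mulrC -exprz_exp -exprnP ae exp1rz mulr1.
Qed.

End OrbitsFinite.

(** * Central characters *)

Theorem theorem4p1 (R : realType) (Fq : finFieldType) (K : closedFieldType)
    (iota : {rmorphism Fq -> K}) (n : nat) (alpha : K)
    (la : mpartn (L K R[i] #|Fq|)) (chi : 'M[K]_n -> R[i]) :
  integralRange iota ->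
  (0 < n)%N ->
  Tm #|Fq| 1 alpha ->
  mparts (@Theta K R[i] #|Fq|) n la ->
  is_chi la chi ->
  chi alpha%:M = valL (omegaL la) 1 alpha * chi 1%:M.
Proof.
move=> algK n0 alT laP [c cv cchi].
have q1 : (1 < #|Fq|)%N by exact: card_finRing_gt1.
have oneT : Tm #|Fq| 1 (1 : K) by exact: Tm1.
have q0 : (0 < #|Fq|)%N by exact: ltnW.
have chiE a : Tm #|Fq| 1 a -> chi a%:M = c (single [set a] (colp n)).
  move=> aT; apply: cchi (scalar_uclass q0 aT n).
  by apply: single_mparts => //; exact: psize_colp.
rewrite (chiE _ alT) (chiE _ oneT); set om := valL _ _ _.
apply/eqP; rewrite -subr_eq0; apply/eqP.
pose D nu := c (single [set alpha] nu) - om * c (single [set 1] nu).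
apply: (hl_separate q1 (D := D) n0) => N v nN; rewrite /D.
have nN' : (0 < n <= N)%N by rewrite n0.
have fin := Phi_finite algK.
have Eal := chi_values_center q1 fin v cv laP alT nN'.
have E1 := chi_values_center q1 fin v cv laP oneT nN'.
have finP := finite_partn n.
rewrite (fsbig_finite _ _ finP) in Eal; rewrite (fsbig_finite _ _ finP) in E1.
rewrite (fsbig_finite _ _ finP) /=.
under eq_bigr do rewrite mulrBl -mulrA.
rewrite sumrB -mulr_sumr -Eal -E1 (valL_omegaL_1 q1 laP.1) mul1r -/om.
by rewrite mulrCA subrr.
Qed.
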